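(* Let $\mathcal{V}$ be a ground set with $|\mathcal{V}|=n$, let $f:2^{\mathcal{V}}\to\mathbb{R}_{\ge 0}$ be a monotone submodular function accessible only through a value oracle, and let $w:\mathcal{V}\to\mathbb{R}_{>0}$ be a weight function with weight ratio $\rho:=\frac{\max_{v\in\mathcal{V}}w(v)}{\min_{v\in\mathcal{V}}w(v)}$. Consider a sequence of updates, each being the insertion or the deletion of an element of $\mathcal{V}$, fixed in advance by an oblivious adversary, and let $V_t\subseteq\mathcal{V}$ be the set of currently present elements after the first $t$ updates. Then for every sufficiently small $\epsilon>0$ there is a randomized algorithm that, after every update $t$, maintains a set $S_t\subseteq V_t$ such that $$\mathbb{E}[f(S_t)]\ge (1-O(\epsilon))\,f(V_t)\quad\text{and}\quad \mathrm{Cost}(S_t)\le O(\epsilon^{-1})\,\mathrm{OPT}_t,$$ i.e. $S_t$ is an expected $(1-O(\epsilon),O(\epsilon^{-1}))$-bicriteria approximate solution, and whose expected amortized number of oracle queries per update is at most $\mathrm{poly}(\log n,\log\rho,\epsilon^{-1})$.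
   Context: For $S\subseteq\mathcal{V}$, $\mathrm{Cost}(S):=\sum_{v\in S}w(v)$. The dynamic submodular cover problem at time $t$ asks for $S\subseteq V_t$ of minimum cost with $f(S)=f(V_t)$; $\mathrm{OPT}_t:=\min\{\mathrm{Cost}(S): S\subseteq V_t,\ f(S)=f(V_t)\}$. A (random) set $S\subseteq V_t$ is an expected $(1-\epsilon',c)$-bicriteria approximate solution if $\mathbb{E}[f(S)]\ge(1-\epsilon')f(V_t)$ and $\mathrm{Cost}(S)\le c\cdot\mathrm{OPT}_t$. An oblivious adversary knows the algorithm but not its random bits, equivalently the whole update sequence is fixed before the algorithm runs. Query complexity counts calls to the oracle returning $f(A)$ for a queried set $A\subseteq\mathcal{V}$; amortized means total number of queries over the first $t$ updates divided by $t$. *)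

(* Defs.v *)
From mathcomp Require Import all_boot all_order all_algebra.
From mathcomp Require Import reals exp.
Set Implicit Arguments. Unset Strict Implicit. Unset Printing Implicit Defensive.
Import Order.TTheory GRing.Theory Num.Theory.
Local Open Scope ring_scope.

Section Defs.
Variables (R : realType) (V : finType).

Definition monotone_setfun (f : {set V} -> R) :=
  forall A B : {set V}, A \subset B -> f A <= f B.
Definition submodular (f : {set V} -> R) :=
  forall A B : {set V}, f (A :|: B) + f (A :&: B) <= f A + f B.

Definition Cost (w : V -> R) (S : {set V}) : R := \sum_(v in S) w v.

(** OPT_t for the present set X = V_t. X itself is feasible, so Cost X is a
    valid initial value for the minimum. *)
Definition OPT (f : {set V} -> R) (w : V -> R) (X : {set V}) : R :=
  \big[Order.min/Cost w X]_(S : {set V} | (S \subset X) && (f S == f X)) Cost w S.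

Definition wmax (w : V -> R) : R := \big[Order.max/0]_(v : V) w v.
Definition wmin (w : V -> R) : R := \big[Order.min/wmax w]_(v : V) w v.
Definition rho (w : V -> R) : R := wmax w / wmin w.

Definition update := (bool * V)%type.
Definition apply_update (X : {set V}) (u : update) : {set V} :=
  if u.1 then u.2 |: X else X :\ u.2.
Definition present (us : seq update) : {set V} := foldl apply_update set0 us.

(** Randomized oracle computations: the only access to f is [Query A],
    which returns f A; randomness is a coin with bias p (clamped to [0,1]). *)
Inductive Comp (A : Type) : Type :=
| Ret : A -> Comp A
| Query : {set V} -> (R -> Comp A) -> Comp A
| Coin : R -> (bool -> Comp A) -> Comp A.

Definition clamp01 (p : R) : R := Order.min 1 (Order.max 0 p).

Fixpoint bind (A B : Type) (c : Comp A) (g : A -> Comp B) : Comp B :=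
  match c with
  | Ret a => g a
  | Query Q k => Query Q (fun r => bind (k r) g)
  | Coin p k => Coin p (fun b => bind (k b) g)
  end.

Fixpoint Ex (f : {set V} -> R) (A : Type) (c : Comp A) (q : nat)
  (h : nat -> A -> R) : R :=
  match c with
  | Ret a => h q a
  | Query Q k => Ex f (k (f Q)) q.+1 h
  | Coin p k => clamp01 p * Ex f (k true) q h + (1 - clamp01 p) * Ex f (k false) q h
  end.

Fixpoint AllLeaves (f : {set V} -> R) (A : Type) (c : Comp A) (P : A -> Prop) : Prop :=
  match c with
  | Ret a => P a
  | Query Q k => AllLeaves f (k (f Q)) P
  | Coin p k => (0 < clamp01 p -> AllLeaves f (k true) P) /\
                (clamp01 p < 1 -> AllLeaves f (k false) P)
  end.

(** A dynamic algorithm: state type St, initial state, and an update handler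
    that (using oracle queries and randomness) returns the new state and the
    maintained set S_t.  [run] processes the update sequence online and
    returns the set maintained after the last update. *)
Fixpoint run (St : Type) (h : St -> update -> Comp (St * {set V}))
  (s : St) (us : seq update) (last : {set V}) : Comp {set V} :=
  match us with
  | [::] => Ret last
  | u :: us' => bind (h s u) (fun p => run h p.1 us' p.2)
  end.

End Defs.

(* Main.v *)
Require Import Defs.
From mathcomp Require Import all_boot all_order all_algebra.
From mathcomp Require Import reals exp.
From mathcomp Require Import sequences zify ring lra.
Import Order.TTheory GRing.Theory Num.Theory.
Local Open Scope ring_scope.

(* For a threshold t, a set T built from elements of marginal at least t * w(v)
   satisfies t * Cost(A) <= f(A) - f(empty) for every part A of it, and if no present
   element still has marginal t * w(v) over T, then f(V_t) - f(T) <= t * OPT.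
   So t = eps * (f(V_t) - f(empty)) / OPT gives value 1 - eps at cost 1/eps, and one
   structure is kept for each t = e^j; an element v matters only to the
   O(log(n rho / eps)) scales j below its own density, which makes the queries
   affordable, and the answer is read off the largest scale whose T is good enough.

   A structure has levels l = L, ..., 0, level l being rebuilt every 2^l relevant
   updates on top of the level above. It picks uniformly random elements among
   those whose marginal lies in the current factor-e bucket, as long as more than
   q * (2^l - 1) of them are left, and passes the few leftovers down. Fewer than
   2^l of the present elements are deleted before the next rebuild, so for an
   oblivious adversary each picked element is deleted with probability at most
   1/q, and the expected loss f(T) - f(T minus deletions) is a small fraction of
   f(T). All random orders are drawn once and reused at all rebuilds and scales,
   because only the expected loss at each single time matters; given them the
   algorithm is deterministic. *)

(** * Expectations and reachable leaves of randomized computations; random orders *)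

Section RandomizedComputations.
Set Implicit Arguments.
Unset Strict Implicit.
Variables (R : realType) (V : finType) (f : {set V} -> R).
Local Notation Comp := (Comp R V).

Lemma clamp01_ge0 (p : R) : 0 <= clamp01 p.
Proof. by rewrite /clamp01 le_min ler01 le_max lexx. Qed.

Lemma clamp01_le1 (p : R) : clamp01 p <= 1.
Proof. by rewrite /clamp01 ge_min lexx. Qed.

Lemma clamp01_id (p : R) : 0 <= p <= 1 -> clamp01 p = p.
Proof. by case/andP=> p0 p1; rewrite /clamp01 max_r // min_r. Qed.

Lemma Ex_bind A B (c : Comp A) (g : A -> Comp B) q h :
  Ex f (bind c g) q h = Ex f c q (fun q' a => Ex f (g a) q' h).
Proof. by elim: c q => [a|S k IH|p k IH] q //=; rewrite !IH. Qed.

Lemma AllLeaves_bind A B (c : Comp A) (g : A -> Comp B) P :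
  AllLeaves f (bind c g) P <-> AllLeaves f c (fun a => AllLeaves f (g a) P).
Proof.
elim: c => [a|S k IH|p k IH] //=.
by split=> -[Ht Hf]; split=> Hp; apply/IH; [apply: Ht|apply: Hf|apply: Ht|apply: Hf].
Qed.

Lemma AllLeaves_imp A (c : Comp A) (P Q : A -> Prop) :
  (forall a, P a -> Q a) -> AllLeaves f c P -> AllLeaves f c Q.
Proof.
move=> PQ; elim: c => [a|S k IH|p k IH] /=; [exact: PQ|exact: IH|].
by case=> Ht Hf; split=> Hp; apply: IH; [apply: Ht|apply: Hf].
Qed.

(** A branch of probability zero contributes nothing to the expectation, so comparing the integrands
    on leaves with [P] is enough. *)
Lemma Ex_mono A (c : Comp A) (P : A -> Prop) q (h h' : nat -> A -> R) :
  AllLeaves f c P -> (forall q a, P a -> h q a <= h' q a) ->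
  Ex f c q h <= Ex f c q h'.
Proof.
move=> + hh'; elim: c q => [a|S k IH|p k IH] q /=; [exact: hh'|exact: IH|].
case=> Ht Hf; apply: lerD.
  have [p0|p0] := ltP 0 (clamp01 p).
    by rewrite ler_pM2l //; apply: IH; apply: Ht.
  by rewrite (_ : clamp01 p = 0) ?mul0r //; apply/le_anti; rewrite p0 clamp01_ge0.
have [p1|p1] := ltP (clamp01 p) 1.
  by rewrite ler_pM2l ?subr_gt0 //; apply: IH; apply: Hf.
by rewrite (_ : clamp01 p = 1) ?subrr ?mul0r //; apply/le_anti; rewrite p1 clamp01_le1.
Qed.

Lemma AllLeavesT A (c : Comp A) : AllLeaves f c (fun=> True).
Proof. by elim: c => //= p k IH; split. Qed.

Lemma Ex_ext A (c : Comp A) (P : A -> Prop) q (h h' : nat -> A -> R) :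
  AllLeaves f c P -> (forall q a, P a -> h q a = h' q a) ->
  Ex f c q h = Ex f c q h'.
Proof.
by move=> cP hh'; apply/le_anti/andP; split; apply: (Ex_mono _ cP) => r a Pa; rewrite hh'.
Qed.

Lemma Ex_const A (c : Comp A) q (x : R) : Ex f c q (fun _ _ => x) = x.
Proof. by elim: c q => [a|S k IH|p k IH] q //=; rewrite !IH; ring. Qed.

Lemma Ex_add A (c : Comp A) q (h h' : nat -> A -> R) :
  Ex f c q (fun q a => h q a + h' q a) = Ex f c q h + Ex f c q h'.
Proof. by elim: c q => [a|S k IH|p k IH] q //=; rewrite !IH; ring. Qed.

Lemma Ex_scale A (c : Comp A) q x (h : nat -> A -> R) :
  Ex f c q (fun q a => x * h q a) = x * Ex f c q h.
Proof. by elim: c q => [a|S k IH|p k IH] q //=; rewrite !IH; ring. Qed.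

Lemma Ex_sum A (c : Comp A) q (I : Type) (r : seq I) (h : I -> nat -> A -> R) :
  Ex f c q (fun q a => \sum_(i <- r) h i q a) = \sum_(i <- r) Ex f c q (h i).
Proof.
elim: r => [|i r IH].
  by under (Ex_ext _ (AllLeavesT c)) => k a _ do rewrite big_nil; rewrite Ex_const big_nil.
under (Ex_ext _ (AllLeavesT c)) => k a _ do rewrite big_cons.
by rewrite Ex_add IH big_cons.
Qed.

(** The query counter is passed on unchanged. Stated through [Ex], this lets random draws be
    separated from the counting of queries. *)
Definition query_free A (c : Comp A) :=
  forall q h, Ex f c q h = Ex f c 0 (fun _ a => h q a).

Lemma query_free_bind A B (c : Comp A) (g : A -> Comp B) :
  query_free c -> (forall a, query_free (g a)) -> query_free (bind c g).
Proof.
move=> hc hg q h; rewrite !Ex_bind hc [RHS]hc.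
by apply: (Ex_ext _ (AllLeavesT c)) => _ a _; rewrite hg.
Qed.

(** The head is returned with probability one over the length, otherwise the draw moves to the tail;
    this makes all entries equally likely. *)
Fixpoint uniform (T : Type) (x : T) (l : seq T) : Comp T :=
  if l is y :: l' then
    @Coin R V _ (size l).+1%:R^-1 (fun b => if b then Ret _ _ x else uniform y l')
  else Ret _ _ x.

Lemma Ex_uniform (T : Type) (x : T) (l : seq T) q h :
  Ex f (uniform x l) q h = (\sum_(y <- x :: l) h q y) / (size l).+1%:R.
Proof.
elim: l x => [|y l IH] x; first by rewrite /= big_seq1 divr1.
rewrite /= -/(uniform _ _) IH clamp01_id; last first.
  by rewrite invr_ge0 ler0n invf_le1 ?ltr0n // ler1n.
rewrite [in RHS]big_cons; set s := \sum_(_ <- _) _; set m := (size l)%:R : R.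
have m0 : 0 <= m by apply: ler0n.
have -> : (size l).+2%:R = m + 2 by rewrite /m -addn2 natrD.
have -> : (size l).+1%:R = m + 1 by rewrite /m -addn1 natrD.
field; apply/andP; split; lra.
Qed.

Lemma query_free_uniform (T : Type) (x : T) (l : seq T) : query_free (uniform x l).
Proof. by move=> q h; rewrite !Ex_uniform. Qed.

Lemma AllLeaves_uniform (T : eqType) (x : T) (l : seq T) :
  AllLeaves f (uniform x l) (fun y => y \in x :: l).
Proof.
elim: l x => [|y l IH] x; first by rewrite /= mem_head.
split=> _ /=; first by rewrite mem_head.
by apply: AllLeaves_imp (IH y) => z zl; rewrite inE zl orbT.
Qed.

(** Sampling without replacement, with [m] meant to be the length of [U]. Drawing one entry at a
    time matches the analysis, which follows the greedy picks one by one. *)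
Fixpoint random_order (m : nat) (U : seq V) : Comp (seq V) :=
  match m, U with
  | m'.+1, x :: l =>
    bind (uniform x l) (fun e =>
      bind (random_order m' (rem e U)) (fun s => Ret _ _ (e :: s)))
  | _, _ => Ret _ _ [::]
  end.

Lemma query_free_random_order m U : query_free (random_order m U).
Proof.
elim: m U => [|m IH] [|x l] //=.
apply: query_free_bind => [|e]; first exact: query_free_uniform.
by apply: query_free_bind => // s.
Qed.

Lemma random_order_perm m U : size U = m ->
  AllLeaves f (random_order m U) (fun s => perm_eq s U).
Proof.
elim: m U => [|m IH] [|x l] // [sU] ; apply/AllLeaves_bind.
apply: AllLeaves_imp (AllLeaves_uniform x l) => e eU; apply/AllLeaves_bind.
have sr : size (rem e (x :: l)) = m by rewrite size_rem.
apply: AllLeaves_imp (IH _ sr) => s sp.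
by change (perm_eq (e :: s) (x :: l)); rewrite (permPr (perm_to_rem eU)) perm_cons.
Qed.

Fixpoint repeat_comp A (k : nat) (c : Comp A) : Comp (seq A) :=
  if k is k'.+1 then
    bind c (fun a => bind (repeat_comp k' c) (fun l => Ret _ _ (a :: l)))
  else Ret _ _ [::].

Lemma query_free_repeat A k (c : Comp A) : query_free c -> query_free (repeat_comp k c).
Proof.
move=> hc; elim: k => //= k IH; apply: query_free_bind => // a.
exact: query_free_bind.
Qed.

Lemma AllLeaves_repeat A k (c : Comp A) (P : A -> bool) :
  AllLeaves f c P ->
  AllLeaves f (repeat_comp k c) (fun l => (size l == k) && all P l).
Proof.
move=> hc; elim: k => //= k IH; apply/AllLeaves_bind.
apply: AllLeaves_imp hc => a Pa; apply/AllLeaves_bind.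
by apply: AllLeaves_imp IH => l /andP[/eqP <- Pl] /=; rewrite eqxx Pa.
Qed.

Lemma Ex_repeatS A k (c : Comp A) (F : seq A -> R) : query_free c ->
  Ex f (repeat_comp k.+1 c) 0 (fun _ => F) =
  Ex f c 0 (fun _ a => Ex f (repeat_comp k c) 0 (fun _ l => F (a :: l))).
Proof.
move=> hc /=; rewrite Ex_bind; apply: (Ex_ext _ (AllLeavesT c)) => q a _.
by rewrite Ex_bind /= (query_free_repeat _ hc).
Qed.

End RandomizedComputations.

(** * Deterministic query programs, their value and their cost *)

Section QueryPrograms.
Set Implicit Arguments.
Unset Strict Implicit.
Variables (R : realType) (V : finType).

(** Without coins a program has one value and one query count for each [f]; randomness enters the
    algorithm only through the orders passed as arguments. *)
Inductive qprog (A : Type) : Type :=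
| QRet of A
| QAsk of {set V} & (R -> qprog A).

Fixpoint qbind A B (c : qprog A) (g : A -> qprog B) : qprog B :=
  match c with
  | QRet a => g a
  | QAsk Q k => QAsk Q (fun r => qbind (k r) g)
  end.

Fixpoint qcomp A (c : qprog A) : Comp R V A :=
  match c with
  | QRet a => Ret _ _ a
  | QAsk Q k => Query Q (fun r => qcomp (k r))
  end.

Variable f : {set V} -> R.

Fixpoint qeval A (c : qprog A) : A :=
  match c with QRet a => a | QAsk Q k => qeval (k (f Q)) end.

Fixpoint qcost A (c : qprog A) : nat :=
  match c with QRet _ => 0 | QAsk Q k => (qcost (k (f Q))).+1 end.

Lemma qeval_bind A B (c : qprog A) (g : A -> qprog B) :
  qeval (qbind c g) = qeval (g (qeval c)).
Proof. by elim: c => //= S k ->. Qed.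

Lemma qcost_bind A B (c : qprog A) (g : A -> qprog B) :
  qcost (qbind c g) = (qcost c + qcost (g (qeval c)))%N.
Proof. by elim: c => //= S k ->. Qed.

Lemma Ex_qcomp A (c : qprog A) q h :
  Ex f (qcomp c) q h = h (q + qcost c)%N (qeval c).
Proof. by elim: c q => [a|S k IH] q /=; rewrite ?addn0 // IH addSnnS. Qed.

Lemma AllLeaves_qcomp A (c : qprog A) P :
  AllLeaves f (qcomp c) P <-> P (qeval c).
Proof. by elim: c => //= S k IH; apply: IH. Qed.

Definition gain (T : {set V}) (v : V) : R := f (v |: T) - f T.

Definition ask_gain (T : {set V}) (v : V) : qprog R :=
  QAsk (v |: T) (fun r => QAsk T (fun r0 => QRet (r - r0))).

(** * One bucket: greedy picking along an order until few good elements remain *)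

Section Phase.
Variables (fuel theta : nat) (thr : V -> R) (P : {set V}).

Fixpoint qgood (T : {set V}) (l : seq V) : qprog {set V} :=
  if l is v :: l' then
    qbind (ask_gain T v) (fun g => qbind (qgood T l') (fun G =>
      QRet (if thr v <= g then v |: G else G)))
  else QRet set0.

(** The scan ignores the stopping rule and records every intermediate set. The stopping point is
    found afterwards by binary search, because recounting the good elements after each pick, as
    [greedy] does, would be too expensive. *)
Fixpoint qscan (T : {set V}) (s : seq V) : qprog (seq {set V}) :=
  if s is v :: s' then
    if v \in P then
      qbind (ask_gain T v) (fun g =>
        qbind (qscan (if thr v <= g then v |: T else T) s') (fun Ts =>
          QRet (T :: Ts)))
    else qbind (qscan T s') (fun Ts => QRet (T :: Ts))
  else QRet [:: T].

Fixpoint qsearch (m : nat) (test : nat -> qprog bool) (lo hi : nat) : qprog nat :=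
  if m is m'.+1 then
    if (lo < hi)%N then
      let mid := ((lo + hi)./2)%N in
      qbind (test mid) (fun b =>
        if b then qsearch m' test lo mid else qsearch m' test mid.+1 hi)
    else QRet hi
  else QRet hi.

Definition qtest (Ts : seq {set V}) (k : nat) : qprog bool :=
  qbind (qgood (nth set0 Ts k) (enum P)) (fun G => QRet (#|G| < theta)%N).

Definition qphase (s : seq V) (T : {set V}) : qprog ({set V} * {set V}) :=
  qbind (qscan T s) (fun Ts =>
    qbind (qsearch fuel (qtest Ts) 0 (size s)) (fun k =>
      qbind (qgood (nth set0 Ts k) (enum P)) (fun G =>
        QRet (nth set0 Ts k, G)))).

Definition good (T : {set V}) : {set V} := [set v in P | thr v <= gain T v].

Definition accept (T : {set V}) (v : V) : {set V} :=
  if v \in good T then v |: T else T.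

Fixpoint greedy (T : {set V}) (s : seq V) : {set V} :=
  if (#|good T| < theta)%N then T
  else if s is v :: s' then greedy (accept T v) s' else T.

Lemma qgood_eval T l : qeval (qgood T l) = [set v in l | thr v <= gain T v].
Proof.
elim: l => [|v l IH] /=; first by apply/setP => u; rewrite !inE.
rewrite qeval_bind /= IH -/(gain T v).
apply/setP => u; case: ifP => Hv; rewrite !inE.
  by case: eqVneq => [->|] //=; rewrite Hv.
by case: eqVneq => [->|] //=; rewrite Hv andbF.
Qed.

Lemma qgood_cost T l : qcost (qgood T l) = (2 * size l)%N.
Proof.
by elim: l => [|v l IH] //=; rewrite qcost_bind /= IH; lia.
Qed.

Lemma qgood_enum T : qeval (qgood T (enum P)) = good T.
Proof. by rewrite qgood_eval; apply/setP => u; rewrite !inE mem_enum. Qed.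

Lemma qscan_eval T s : qeval (qscan T s) = T :: scanl accept T s.
Proof.
elim: s T => [|v s IH] T //=; case: ifP => vP; rewrite /= qeval_bind /= IH.
  by rewrite /accept !inE vP.
by rewrite /accept !inE vP.
Qed.

Lemma qscan_cost T s : uniq s -> (qcost (qscan T s) <= 2 * #|P|)%N.
Proof.
move=> us; suff -> : qcost (qscan T s) = (2 * count (mem P) s)%N.
  rewrite leq_mul2l /= -size_filter cardE; apply: uniq_leq_size; first exact: filter_uniq.
  by move=> u; rewrite mem_filter mem_enum => /andP[].
elim: s T {us} => [|v s IH] T //=.
by case: ifP => vP; rewrite /= qcost_bind /= IH; lia.
Qed.

Lemma qsearch_spec m (test : nat -> qprog bool) lo hi :
  (hi - lo < 2 ^ m)%N -> (lo <= hi)%N ->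
  {homo (fun k => qeval (test k)) : i j / (i <= j)%N >-> i ==> j} ->
  qeval (test hi) -> (forall k, (k < lo)%N -> ~~ qeval (test k)) ->
  let r := qeval (qsearch m test lo hi) in
  [/\ qeval (test r), (r <= hi)%N & forall k, (k < r)%N -> ~~ qeval (test k)].
Proof.
move=> + + mono; elim: m lo hi => [|m IH] lo hi /=.
  rewrite expn0 => h1 h2 hhi hlo; split=> // k kh; apply: hlo; lia.
rewrite expnS => h1 h2 hhi hlo; case: ltnP => lh /=; last first.
  by split=> // k kh; apply: hlo; lia.
rewrite qeval_bind; have mh : ((lo + hi)./2 < hi)%N by lia.
case Et: (qeval (test (lo + hi)./2)).
  have h1' : ((lo + hi)./2 - lo < 2 ^ m)%N by lia.
  have h2' : (lo <= (lo + hi)./2)%N by lia.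
  have [tr rh hlt] := IH _ _ h1' h2' Et hlo.
  by split=> //; apply: leq_trans rh (ltnW mh).
apply: IH => // [|k kl]; first lia.
apply/negP => tk; have /implyP/(_ tk) := mono k (lo + hi)./2 (ltac:(lia)).
by rewrite Et.
Qed.

Lemma qsearch_cost m (test : nat -> qprog bool) lo hi c :
  (forall k, (qcost (test k) <= c)%N) ->
  (qcost (qsearch m test lo hi) <= m * c)%N.
Proof.
move=> hc; elim: m lo hi => [|m IH] lo hi //=.
case: ltnP => _ //; rewrite qcost_bind mulSn; apply: leq_add; first exact: hc.
by case: (qeval _).
Qed.

Hypotheses (fmono : monotone_setfun f) (fsub : submodular f).

(** Submodularity is applied to [v |: T] and [T']. Their intersection contains [T] but may be
    larger, and monotonicity compares the two. *)
Lemma gain_anti (T T' : {set V}) v : T \subset T' -> gain T' v <= gain T v.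
Proof.
move=> sTT'; rewrite /gain; have := fsub (v |: T) T'.
rewrite -setUA (setUidPr sTT') => H.
have := fmono (A := T) (B := (v |: T) :&: T'); rewrite subsetI subsetUr sTT' => /(_ isT).
lra.
Qed.

Lemma gain_mem (T : {set V}) v : v \in T -> gain T v = 0.
Proof. by move=> vT; rewrite /gain (setUidPr _) ?subrr // sub1set. Qed.

Lemma good_anti (T T' : {set V}) : T \subset T' -> good T' \subset good T.
Proof.
move=> sTT'; apply/subsetP => v; rewrite !inE => /andP[-> /=] h.
exact: le_trans h (gain_anti _ sTT').
Qed.

Lemma accept_sub (T : {set V}) v : T \subset accept T v.
Proof. by rewrite /accept; case: ifP => // _; apply: subsetUr. Qed.

Hypothesis thr_gt0 : forall v, 0 < thr v.

Lemma good_notin (T : {set V}) v : v \in T -> v \notin good T.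
Proof. by move=> vT; rewrite inE gain_mem // leNgt thr_gt0 andbF. Qed.

Lemma accept_notin_good T v : v \notin good (accept T v).
Proof.
rewrite /accept; case: ifPn => // _; apply: good_notin; exact: setU11.
Qed.

Lemma greedy_first T s k : (k <= size s)%N ->
  (#|good (foldl accept T (take k s))| < theta)%N ->
  (forall k', (k' < k)%N -> ~~ (#|good (foldl accept T (take k' s))| < theta)%N) ->
  greedy T s = foldl accept T (take k s).
Proof.
elim: s T k => [|v s IH] T k /=; first by case: k => //= _ ->.
case: k => [|k] ks /=; first by move=> ->.
move=> gk hk; have := hk 0%N isT; rewrite take0 /= => /negPf ->.
by apply: IH => // k' k'k; apply: (hk k'.+1).
Qed.

Lemma foldl_accept_sub (T : {set V}) s : T \subset foldl accept T s.
Proof.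
by elim: s T => //= v s IH T; apply: subset_trans (accept_sub T v) (IH _).
Qed.

(** Once its turn is over an element is never good again: if accepted its gain is zero, if rejected
    its gain was too small, and gains only decrease. *)
Lemma foldl_accept_good T s v : v \in s -> v \notin good (foldl accept T s).
Proof.
elim: s T => //= u s IH T; rewrite inE => /orP[/eqP ->|/IH //].
apply: contra (accept_notin_good T u); apply/subsetP/good_anti.
exact: foldl_accept_sub.
Qed.

Lemma nth_scan T s k : (k <= size s)%N ->
  nth set0 (T :: scanl accept T s) k = foldl accept T (take k s).
Proof.
case: k => [|k] ks /=; first by rewrite take0.
by rewrite nth_scanl.
Qed.

Lemma qphase_eval (s : seq V) T : (0 < theta)%N -> {subset P <= s} -> (size s < 2 ^ fuel)%N ->
  qeval (qphase s T) = (greedy T s, good (greedy T s)) /\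
  (#|good (greedy T s)| < theta)%N.
Proof.
move=> th0 Ps sf; rewrite /qphase qeval_bind qscan_eval.
set Ts := _ :: _.
have testE k : qeval (qtest Ts k) = (#|good (nth set0 Ts k)| < theta)%N.
  by rewrite /qtest qeval_bind qgood_enum.
rewrite qeval_bind.
(* Beyond the end of [Ts] the default [set0] could have many good elements. Declaring the test true
   there makes it monotone in [k], and the search stays within the range. *)
pose test k := if (k <= size s)%N then qtest Ts k else QRet true.
have testq m lo hi : (hi <= size s)%N ->
    qeval (qsearch m (qtest Ts) lo hi) = qeval (qsearch m test lo hi).
  elim: m lo hi => //= m IH lo hi hs; case: ltnP => // lh.
  have tm : test (lo + hi)./2 = qtest Ts (lo + hi)./2.
    by rewrite /test ifT //; lia.
  rewrite tm 2!(qeval_bind (qtest _ _)).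
  by case: (qeval (qtest _ _)); apply: IH; lia.
rewrite testq //.
have := @qsearch_spec fuel test 0 (size s).
rewrite subn0 leq0n => /(_ sf isT).
have mono : {homo (fun k => qeval (test k)) : i j / (i <= j)%N >-> i ==> j}.
  move=> i j ij; apply/implyP; rewrite /test; case: (leqP j) => // js.
  rewrite ifT ?(leq_trans ij) // !testE; apply: leq_ltn_trans.
  rewrite /Ts !nth_scan ?(leq_trans ij) //; apply/subset_leq_card/good_anti.
  by rewrite -(subnKC ij) takeD foldl_cat foldl_accept_sub.
move=> /(_ mono); rewrite {1}/test leqnn testE /Ts nth_scan // take_size.
(* The order contains all of [P], so nothing is good after a full scan and the right end of the
   search passes the test. *)
have -> : good (foldl accept T s) = set0.
  apply/eqP; rewrite -subset0; apply/subsetP => v vg.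
  have vP : v \in P by move: vg; rewrite inE => /andP[].
  by have := foldl_accept_good T (Ps _ vP); rewrite vg.
rewrite cards0 => /(_ th0) [] //; set r := qeval (qsearch _ _ _ _) => hr rs hlt.
have E : greedy T s = nth set0 Ts r.
  rewrite nth_scan //; apply: greedy_first => //.
    by move: hr; rewrite /test rs testE /Ts nth_scan.
  move=> k kr; move: (hlt _ kr); rewrite /test ifT; last by lia.
  by rewrite testE /Ts nth_scan //; lia.
rewrite qeval_bind -/Ts qgood_enum E; split => //.
by move: hr; rewrite /test rs testE.
Qed.

(** One scan, at most [fuel] counts of good elements during the search and one final count, each
    within [2 * #|P|] queries. *)
Lemma qphase_cost s T : uniq s -> (qcost (qphase s T) <= 2 * #|P| * fuel.+2)%N.
Proof.
move=> us; rewrite /qphase qcost_bind; set Ts := qeval _.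
rewrite qcost_bind; set k := qeval _.
rewrite qcost_bind qgood_cost -cardE /= addn0.
have := qscan_cost T us; have : (qcost (qsearch fuel (qtest Ts) 0 (size s)) <= fuel * (2 * #|P|))%N.
  by apply: qsearch_cost => j; rewrite /qtest qcost_bind qgood_cost -cardE /= addn0.
move=> h1 h2.
apply: leq_trans (leq_add h2 (leq_add h1 (leqnn _))) _.
by rewrite (mulnC fuel) !mulnS leq_add2l addnC.
Qed.

Lemma greedy_sub (T : {set V}) s : T \subset greedy T s.
Proof.
elim: s T => [|v s IH] T /=; case: ifP => // _.
exact: subset_trans (accept_sub T v) (IH _).
Qed.

(** * Expected loss caused by later deletions *)

Section ExpectedLoss.
Variables (D : {set V}) (eps lo hi : R).
Hypotheses (lo_ge0 : 0 <= lo) (eps_ge0 : 0 <= eps).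
Hypothesis thr_lo : forall v, lo <= thr v.
Hypothesis bigD : #|P :&: D|%:R * hi <= eps * lo * theta%:R.

(* The term in parentheses is the value lost once the elements of [D] are deleted. *)
Definition potential (T : {set V}) : R := eps * f T - (f T - f (T :\: D)).

(** If [v] is in [D], the surviving set stays the same and the loss grows by a gain below [hi]. If
    not, [v] gains at least as much over [T :\: D] as over [T], so the loss does not grow. In both
    cases [f T] rises by at least [lo]. *)
Lemma potential_accept T v : gain T v < hi -> v \in good T ->
  potential T + (eps * lo - (v \in D)%:R * hi) <= potential (accept T v).
Proof.
move=> vhi vg; rewrite /accept vg /potential.
have lov : lo <= gain T v.
  by apply: le_trans (thr_lo v) _; move: vg; rewrite inE => /andP[].
have eg : eps * lo <= eps * gain T v by apply: ler_wpM2l.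
have fE : f (v |: T) = f T + gain T v by rewrite /gain; ring.
rewrite fE mulrDr; have [vD|vD] := boolP (v \in D).
  have -> : (v |: T) :\: D = T :\: D.
    by apply/setP => u; rewrite !inE; case: eqVneq => [->|//]; rewrite vD.
  by rewrite mul1r; lra.
have -> : (v |: T) :\: D = v |: (T :\: D).
  by apply/setP => u; rewrite !inE; case: eqVneq => [->|//]; rewrite vD.
have gD := @gain_anti (T :\: D) T v (subsetDl _ _).
have -> : f (v |: (T :\: D)) = f (T :\: D) + gain (T :\: D) v by rewrite /gain; ring.
rewrite mul0r; lra.
Qed.

(* An accepted element is uniform among the good ones, of which there are at
   least [theta]: it lies in [D] with probability at most [#|P :&: D| / theta]. *)
Lemma potential_greedy m U T : uniq U -> size U = m -> {subset good T <= U} ->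
  {in good T, forall v, gain T v < hi} ->
  potential T <= Ex f (random_order R m U) 0 (fun _ s => potential (greedy T s)).
Proof.
elim: m U T => [|m IH] U T uU sU gU Phi.
  by case: U {uU gU} sU => //= _; case: ifP.
case: U uU sU gU => // x l uU sU gU; have [gt|gt] := ltnP #|good T| theta.
  rewrite (@Ex_ext _ _ f _ _ (fun=> True) 0 _ (fun _ _ => potential T)) ?Ex_const //.
    exact: AllLeavesT.
  by move=> _ [|y s] _ /=; rewrite gt.
rewrite /= Ex_bind.
(* After drawing [e], the rest is a random order of the remaining list, which still contains all
   good elements because [e] is no longer good. *)
have step q e : e \in x :: l -> potential (accept T e) <=
    Ex f (bind (random_order R m (rem e (x :: l))) (fun s => Ret R V (e :: s))) q
       (fun _ s => potential (greedy T s)).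
  move=> eU; rewrite Ex_bind /= query_free_random_order.
  rewrite (@Ex_ext _ _ f _ _ (fun=> True) 0 _ (fun _ s => potential (greedy (accept T e) s))).
  - apply: IH; first exact: (rem_uniq e uU).
    + by have := size_rem eU; rewrite sU.
    + move=> v vg; change (v \in rem e (x :: l)); rewrite (mem_rem_uniq _ uU) inE.
      apply/andP; split; last by apply: gU; apply: (subsetP (good_anti (accept_sub T e))).
      by apply: contraTneq vg => ->; apply: accept_notin_good.
    + move=> v /(subsetP (good_anti (accept_sub T e))) vg.
      by apply: le_lt_trans (Phi _ vg); apply/gain_anti/accept_sub.
  - exact: AllLeavesT.
  - by move=> _ s _ /=; rewrite ltnNge gt.
apply: (@le_trans _ _ (Ex f (uniform R V x l) 0 (fun _ e => potential (accept T e)))); last first.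
  by apply: (Ex_mono _ (AllLeaves_uniform f x l)) => q e; apply: step.
rewrite Ex_uniform ler_pdivlMr ?ltr0n //.
have -> : potential T * (size l).+1%:R = \sum_(e <- x :: l) potential T.
  by rewrite big_const_seq count_predT iter_addr addr0 mulr_natr.
(* A drawn entry that is not good leaves [T] unchanged; it remains to see that the increments [d]
   have a nonnegative sum. *)
pose d e := if e \in good T then eps * lo - (e \in D)%:R * hi else 0.
have : \sum_(e <- x :: l) (potential T + d e) <= \sum_(e <- x :: l) potential (accept T e).
  apply: ler_sum => e _; rewrite /d; case: ifP => eg.
    by apply: potential_accept => //; apply: Phi.
  by rewrite addr0 /accept eg.
rewrite big_split /=; apply: le_trans; rewrite lerDl.
rewrite /d -big_mkcond /= -big_filter.
have pg : perm_eq [seq i <- x :: l | i \in good T] (enum (good T)).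
  apply: uniq_perm; [exact: filter_uniq|exact: enum_uniq|move=> v].
  by rewrite mem_filter mem_enum; apply/andb_idr/gU.
rewrite (perm_big _ pg) /= big_enum /= big_split /= sumr_const sumrN -mulr_suml.
rewrite -natr_sum; have -> : (\sum_(i in good T) (i \in D) = #|good T :&: D|)%N.
  rewrite -sum1_card [LHS]big_mkcond [RHS]big_mkcond /=; apply: eq_bigr => i _.
  by rewrite in_setI; case: (i \in good T); case: (i \in D).
rewrite subr_ge0 -[leRHS]mulr_natr.
case: (lerP 0 hi) => [hi0|hi0]; last first.
  apply: (@le_trans _ _ 0); first by rewrite mulr_ge0_le0 // ltW.
  by rewrite !mulr_ge0.
have sgP : good T :&: D \subset P :&: D.
  by apply: setSI; apply/subsetP => v; rewrite inE => /andP[].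
apply: (@le_trans _ _ (#|P :&: D|%:R * hi)).
  by rewrite ler_wpM2r // ler_nat subset_leq_card.
apply: le_trans bigD _; rewrite ler_wpM2l ?mulr_ge0 // ler_nat //.
Qed.

End ExpectedLoss.

End Phase.
End QueryPrograms.

(** * Present elements, filtered update sequences and snapshots *)

Section Presence.
Set Implicit Arguments.
Unset Strict Implicit.
Variable V : finType.
Implicit Types (us : seq (update V)) (X : {set V}).

Lemma present_cat us us' : present (us ++ us') = foldl (@apply_update V) (present us) us'.
Proof. by rewrite /present foldl_cat. Qed.

Lemma foldl_update_diff us X : (#|X :\: foldl (@apply_update V) X us| <= size us)%N.
Proof.
elim: us X => [|u us IH] X /=; first by rewrite setDv cards0.
apply: leq_trans (_ : #|u.2 |: (apply_update X u :\: foldl (@apply_update V) (apply_update X u) us)| <= _)%N.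
  apply/subset_leq_card/subsetP => v; rewrite !inE => /andP[-> vX].
  by case: eqVneq => //= vu; rewrite /apply_update; case: ifP; rewrite !inE vX ?orbT ?vu.
by apply: leq_trans (leq_card_setU _ _) _; rewrite cards1 add1n ltnS.
Qed.

Lemma foldl_update_new us X : (#|foldl (@apply_update V) X us :\: X| <= size us)%N.
Proof.
elim: us X => [|u us IH] X /=; first by rewrite setDv cards0.
apply: leq_trans (_ : #|u.2 |: (foldl (@apply_update V) (apply_update X u) us :\: apply_update X u)| <= _)%N.
  apply/subset_leq_card/subsetP => v; rewrite !inE => /andP[vX ->].
  case: eqVneq => //= vu; rewrite andbT /apply_update; case: ifP; rewrite !inE (negPf vX) ?andbF //.
  by rewrite (negPf vu).
by apply: leq_trans (leq_card_setU _ _) _; rewrite cards1 add1n ltnS.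
Qed.

Lemma present_mem us v : v \in present us -> exists2 u, u \in us & u.2 = v.
Proof.
rewrite /present -(revK us) foldl_rev; elim: (rev us) => [|u l IH] /=; first by rewrite inE.
have sub : {subset rev l <= rev (u :: l)} by move=> x; rewrite !mem_rev inE orbC => ->.
rewrite {1}/apply_update; case: ifP => _; rewrite !inE.
  case/orP=> [/eqP ->|/IH[x /sub xl <-]]; last by exists x.
  by exists u => //; rewrite mem_rev mem_head.
by case/andP=> _ /IH[x /sub xl <-]; exists x.
Qed.

(** Updates of different elements do not interact, so a scale can treat the subsequence of updates
    relevant to it as its whole input. *)
Lemma present_filter (W : {set V}) us :
  present [seq u <- us | u.2 \in W] = present us :&: W.
Proof.
rewrite /present -(revK us) filter_rev !foldl_rev.
elim: (rev us) => [|u l IH] /=; first by rewrite set0I.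
apply/setP => v; case: ifP => uW; rewrite /= ?IH /apply_update; case: ifP => _; rewrite !inE.
- by case: eqVneq => [->|] //=; rewrite uW.
- by rewrite andbA.
- by case: eqVneq => [->|] //=; rewrite uW andbF.
- by case: eqVneq => [->|] //=; rewrite uW andbF.
Qed.

(* The present set when level [l], of period [2 ^ l], was last rebuilt. *)
Definition snapshot (l : nat) us : {set V} :=
  present (take (size us %/ 2 ^ l * 2 ^ l) us).

Lemma snapshot_diff l us : (#|snapshot l us :\: present us| <= 2 ^ l - 1)%N.
Proof.
rewrite /snapshot; set t := (_ * _)%N.
have -> : present us = foldl (@apply_update V) (present (take t us)) (drop t us).
  by rewrite -present_cat cat_take_drop.
apply: leq_trans (foldl_update_diff _ _) _; rewrite size_drop /t.
have := divn_eq (size us) (2 ^ l); have := @ltn_pmod (size us) (2 ^ l); rewrite expn_gt0 => /(_ isT).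
lia.
Qed.

Lemma snapshot_new l us : (#|present us :\: snapshot l us| <= 2 ^ l - 1)%N.
Proof.
rewrite /snapshot; set t := (_ * _)%N.
have -> : present us = foldl (@apply_update V) (present (take t us)) (drop t us).
  by rewrite -present_cat cat_take_drop.
apply: leq_trans (foldl_update_new _ _) _; rewrite size_drop /t.
have := divn_eq (size us) (2 ^ l); have := @ltn_pmod (size us) (2 ^ l); rewrite expn_gt0 => /(_ isT).
lia.
Qed.

Lemma snapshot_rebuild l us : (2 ^ l %| size us)%N -> snapshot l us = present us.
Proof. by move=> d; rewrite /snapshot divnK // take_size. Qed.

Lemma snapshot_keep l us u : ~~ (2 ^ l %| (size us).+1)%N ->
  snapshot l (rcons us u) = snapshot l us.
Proof.
move=> d; rewrite /snapshot size_rcons divnS ?expn_gt0 // (negPf d) add0n.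
by rewrite -cats1 takel_cat // leq_divM.
Qed.

Lemma snapshot_mem l us v : v \in snapshot l us -> exists2 u, u \in us & u.2 = v.
Proof. by case/present_mem => u /mem_take us_u <-; exists u. Qed.

End Presence.

(** * The levels of the structure at one fixed scale *)

Section Levels.
Set Implicit Arguments.
Unset Strict Implicit.
Variables (R : realType) (V : finType) (w : V -> R) (tau beta c : R) (q fuel : nat).

Record entry := Entry { snap : {set V}; chosen : {set V}; rest : {set V} }.

Definition entry0 := Entry set0 set0 set0.

(* At most [2 ^ l - 1] elements are deleted between two rebuilds of level [l], so
   [q] times as many good ones suffice; at level 0 nothing may be left over. *)
Definition min_good (l : nat) : nat := (q * (2 ^ l - 1)).+1.

(** The second term keeps every pick at density at least [tau]; the first keeps the gains within a
    bucket comparable, as the loss bound requires. *)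
Definition bucket_thr (i : nat) (v : V) : R := Num.max (beta * c ^+ i) (tau * w v).

(** The bucket index is the number of orders still to come, so thresholds decrease. Good elements
    left by a bucket leave the pool [P] and are collected in [Z]. *)
Fixpoint qbuckets (th : nat) (ch : seq (seq V)) (T P Z : {set V}) :
    qprog R V ({set V} * {set V}) :=
  if ch is s :: ch' then
    qbind (qphase fuel th (bucket_thr (size ch')) P s T) (fun TG =>
      qbuckets th ch' TG.1 (P :\: TG.2) (Z :|: TG.2))
  else QRet _ _ (T, Z).

(** An element of the snapshot of [e] that was not left over has gain below [tau * w v] over
    [chosen e], hence over every larger set, and can be skipped. *)
Definition candidates (X : {set V}) (e : entry) := X :&: (rest e :|: ~: snap e).

Definition qbuild (ch : seq (seq V)) (l : nat) (X : {set V}) (e : entry) :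
    qprog R V entry :=
  qbind (qbuckets (min_good l) ch (chosen e) (candidates X e) set0) (fun TZ =>
    QRet _ _ (Entry X TZ.1 TZ.2)).

Fixpoint qupdate (om : seq (seq (seq V))) (es : seq entry) (prev : entry)
    (t : nat) (X : {set V}) : qprog R V (seq entry) :=
  match om, es with
  | ch :: om', e :: es' =>
    if (2 ^ size om' %| t)%N then
      qbind (qbuild ch (size om') X prev) (fun e' =>
        qbind (qupdate om' es' e' t X) (fun es'' => QRet _ _ (e' :: es'')))
    else qbind (qupdate om' es' e t X) (fun es'' => QRet _ _ (e :: es''))
  | _, _ => QRet _ _ [::]
  end.

Variable f : {set V} -> R.

(** A closed form of the maintained entries: given the orders they depend only on snapshots, so the
    loss at one time is that of a single build from the top level down. *)
Fixpoint levels (om : seq (seq (seq V))) (prev : entry) (us : seq (update V)) :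
    seq entry :=
  if om is ch :: om' then
    let e := qeval f (qbuild ch (size om') (snapshot (size om') us) prev) in
    e :: levels om' e us
  else [::].

Hypotheses (fmono : monotone_setfun f) (fsub : submodular f).
Hypotheses (beta_gt0 : 0 < beta) (c_ge1 : 1 <= c).
Hypothesis beta_tau : forall v, beta <= tau * w v.
Hypothesis card_fuel : (#|V| < 2 ^ fuel)%N.

Definition is_order (s : seq V) := perm_eq s (enum V).
Definition is_chunk (k : nat) (ch : seq (seq V)) := (size ch == k) && all is_order ch.

Lemma is_order_mem s v : is_order s -> v \in s.
Proof. by move=> /perm_mem ->; rewrite mem_enum. Qed.

Lemma is_order_uniq s : is_order s -> uniq s.
Proof. by move=> /perm_uniq ->; rewrite enum_uniq. Qed.

Lemma is_order_size s : is_order s -> (size s < 2 ^ fuel)%N.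
Proof. by move=> /perm_size ->; rewrite -cardE. Qed.

Lemma bucket_thr_gt0 i v : 0 < bucket_thr i v.
Proof.
by rewrite /bucket_thr lt_max mulr_gt0 ?exprn_gt0 // (lt_le_trans ltr01).
Qed.

Lemma qphase_order th i P s T : (0 < th)%N -> is_order s ->
  let T' := greedy f th (bucket_thr i) P T s in
  qeval f (qphase fuel th (bucket_thr i) P s T) = (T', good f (bucket_thr i) P T') /\
  (#|good f (bucket_thr i) P T'| < th)%N.
Proof.
move=> th0 os; apply: qphase_eval => //.
- exact: bucket_thr_gt0.
- by move=> v _; apply: is_order_mem.
- exact: is_order_size.
Qed.

(** Required of every part of [T], so that the cost bound survives deletions. *)
Definition dense (T : {set V}) :=
  forall A : {set V}, A \subset T -> tau * Cost w A <= f A - f set0.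

Lemma dense_accept i P T v : dense T -> dense (accept f (bucket_thr i) P T v).
Proof.
move=> dT; rewrite /accept; case: ifP => // vg A sA.
have [vA|vA] := boolP (v \in A); last first.
  apply: dT; apply/subsetP => u uA; have := subsetP sA _ uA.
  by rewrite !inE; case: eqVneq uA vA => // -> ->.
have sAT : A :\ v \subset T by rewrite subDset.
have := dT _ sAT; have g1 := gain_anti fmono fsub v sAT.
have g2 : tau * w v <= gain f T v.
  by move: vg; rewrite inE => /andP[_]; apply: le_trans; rewrite le_max lexx orbT.
rewrite {2}/Cost (big_setD1 v vA) /= -/(Cost w (A :\ v)) mulrDr.
have -> : f A = f (A :\ v) + gain f (A :\ v) v by rewrite /gain setD1K //; ring.
lra.
Qed.

Lemma dense_greedy i P th T s : dense T -> dense (greedy f th (bucket_thr i) P T s).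
Proof.
elim: s T => [|v s IH] T dT /=; case: ifP => // _.
by apply: IH; apply: dense_accept.
Qed.

Lemma bucket_thr0 v : bucket_thr 0 v = tau * w v.
Proof. by rewrite /bucket_thr expr0 mulr1 max_r. Qed.

(** On entering a bucket, the pool has gains below the previous threshold. Elements still good
    afterwards go to [Z], the others are below the current threshold, and the last threshold is
    [tau * w v]. *)
Lemma qbuckets_spec th ch (T P Z : {set V}) : (0 < th)%N -> all is_order ch ->
  {in P, forall v, gain f T v < bucket_thr (size ch) v} ->
  let TZ := qeval f (qbuckets th ch T P Z) in
  [/\ dense T -> dense TZ.1, T \subset TZ.1, Z \subset TZ.2,
      (#|TZ.2| <= #|Z| + size ch * th.-1)%N &
      {in P, forall v, v \in TZ.2 \/ gain f TZ.1 v < tau * w v}].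
Proof.
move=> th0; elim: ch T P Z => [|s ch IH] T P Z /=.
  move=> _ h; split=> //; first by rewrite addn0.
  by move=> v vP; right; rewrite -bucket_thr0 h.
case/andP=> os och h; rewrite qeval_bind.
have [-> ] := @qphase_order th (size ch) P s T th0 os.
set T' := greedy _ _ _ _ _ _; set G := good _ _ _ _ => sG /=.
have TT' : T \subset T' by apply: greedy_sub.
have [] := IH T' (P :\: G) (Z :|: G) och.
  by move=> v; rewrite !inE => /andP[+ vP]; rewrite vP /= -ltNge.
set TZ := qeval _ _ => dTZ sT sZ szZ hP; split.
- by move=> dT; apply: dTZ; apply: dense_greedy.
- exact: subset_trans sT.
- by apply: subset_trans sZ; apply: subsetUl.
- apply: leq_trans szZ _; rewrite mulSn addnA leq_add2r.
  by apply: leq_trans (leq_card_setU _ _) _; rewrite leq_add2l; lia.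
- move=> v vP; have [vG|vG] := boolP (v \in G).
    by left; apply: (subsetP sZ); rewrite inE vG orbT.
  by apply: hP; rewrite inE vG.
Qed.

Lemma qbuckets_cost th ch (T P Z : {set V}) : (0 < th)%N -> all is_order ch ->
  (qcost f (qbuckets th ch T P Z) <= size ch * (2 * #|P| * fuel.+2))%N.
Proof.
move=> th0; elim: ch T P Z => [|s ch IH] T P Z //=.
case/andP=> os och; rewrite qcost_bind mulSn; apply: leq_add.
  by apply: qphase_cost; apply: is_order_uniq.
apply: leq_trans (IH _ _ _ och) _; rewrite leq_mul2l leq_mul2r leq_mul2l /=.
by rewrite subset_leq_card ?orbT // subsetDl.
Qed.

Lemma qbuckets_empty th ch T : (0 < th)%N -> all is_order ch ->
  qeval f (qbuckets th ch T set0 set0) = (T, set0).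
Proof.
move=> th0; elim: ch => [|s ch IH] //= /andP[os och].
rewrite qeval_bind; have [-> _] := @qphase_order th (size ch) set0 s T th0 os.
have good0 i S : good f (bucket_thr i) set0 S = set0.
  by apply/setP => v; rewrite !inE.
have -> : greedy f th (bucket_thr (size ch)) set0 T s = T.
  by case: (s) => [|v s'] /=; rewrite good0 cards0 th0.
by rewrite good0 setD0 setU0 IH.
Qed.

Variable I : nat.

Lemma qbuckets_potential k th (D : {set V}) (eps : R) (T P Z : {set V}) : (0 < th)%N -> 0 <= eps ->
  #|P :&: D|%:R * c <= eps * th%:R ->
  {in P, forall v, gain f T v < bucket_thr k v} ->
  potential f D eps T <=
  Ex f (repeat_comp k (random_order R #|V| (enum V))) 0
    (fun _ ch => potential f D eps (qeval f (qbuckets th ch T P Z)).1).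
Proof.
move=> th0 eps0; elim: k T P Z => [|k IH] T P Z hD hP //.
rewrite Ex_repeatS; last exact: query_free_random_order.
have thr_gt0 := bucket_thr_gt0 k.
have bc : 0 <= beta * c ^+ k by rewrite mulr_ge0 ?exprn_ge0 ?ltW // (lt_le_trans ltr01).
apply: le_trans (@potential_greedy _ _ f th (bucket_thr k) P fmono fsub thr_gt0
  D eps (beta * c ^+ k) (beta * c ^+ k.+1) bc eps0 _ _ #|V| (enum V) T _ _ _ _) _.
- by move=> v; rewrite le_max lexx.
- have -> : beta * c ^+ k.+1 = c * (beta * c ^+ k) by rewrite exprS; ring.
  by rewrite mulrA (mulrAC eps); apply: ler_wpM2r.
- exact: enum_uniq.
- by rewrite -cardE.
- by move=> v _; rewrite mem_enum.
(* The gain is below one of the two terms of [bucket_thr k.+1]; being below [tau * w v] would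
   contradict goodness, so it is below [beta * c ^+ k.+1]. *)
- move=> v; rewrite inE => /andP[vP]; have := hP _ vP.
  by rewrite /bucket_thr ge_max lt_max => /orP[//|h1] /andP[_]; rewrite leNgt h1.
have or : AllLeaves f (random_order R #|V| (enum V)) is_order.
  by apply: random_order_perm; rewrite -cardE.
apply: (Ex_mono _ or) => _ s os.
have [E _] := @qphase_order th k P s T th0 os; rewrite -/(greedy _ _ _ _ _ _) in E.
set T' := greedy _ _ _ _ _ _ in E *; set G := good _ _ _ _ in E.
apply: le_trans (IH T' (P :\: G) (Z :|: G) _ _) _.
- apply: le_trans hD; rewrite ler_wpM2r ?(le_trans ler01) // ler_nat.
  by apply/subset_leq_card/setSI/subsetDl.
- by move=> v; rewrite !inE => /andP[+ vP]; rewrite vP /= -ltNge.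
apply: (Ex_mono _ (AllLeaves_repeat _ or)) => _ ch /andP[/eqP sch _].
by rewrite /= sch qeval_bind E.
Qed.

Definition small (v : V) := gain f set0 v < beta * c ^+ I.

Lemma small_candidates (X : {set V}) e T : {in X, forall v, small v} ->
  {in candidates X e, forall v, gain f T v < bucket_thr I v}.
Proof.
move=> hX v; rewrite inE => /andP[/hX vs _].
by rewrite lt_max (le_lt_trans (gain_anti fmono fsub v (sub0set T))).
Qed.

Definition entry_ok (e : entry) :=
  dense (chosen e) /\
  {in snap e, forall v, v \in rest e \/ gain f (chosen e) v < tau * w v}.

Lemma entry0_ok : entry_ok entry0.
Proof.
split=> [A /=|v]; last by rewrite inE.
by rewrite subset0 => /eqP ->; rewrite /Cost big_set0 mulr0 subrr.
Qed.

(** Elements of [X] outside the candidates were settled by [e], and smaller gains over a larger set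
    keep them settled. Each of the [I] buckets leaves fewer than [min_good l] elements. *)
Lemma qbuild_spec ch l (X : {set V}) e : is_chunk I ch -> {in X, forall v, small v} ->
  let e' := qeval f (qbuild ch l X e) in
  [/\ snap e' = X, entry_ok e -> entry_ok e' &
      (#|rest e'| <= I * (q * (2 ^ l - 1)))%N].
Proof.
move=> /andP[/eqP sch och] hX; rewrite /qbuild qeval_bind /=.
have hC := small_candidates (e := e) (chosen e) hX; rewrite -sch in hC.
have [] := qbuckets_spec set0 (th := min_good l) isT och hC.
set TZ := qeval f _ => dTZ sT _; rewrite cards0 add0n sch => szZ hP; split=> //.
case=> de he; split=> /=; first exact: dTZ.
move=> v vX; have [vC|vC] := boolP (v \in candidates X e); first exact: hP.
right; move: vC; rewrite !inE vX /= negb_or negbK => /andP[vr vs].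
have [|] := he _ vs; first by rewrite (negPf vr).
by apply: le_lt_trans; apply: gain_anti.
Qed.

Lemma qbuild_cost ch l X e : is_chunk I ch ->
  (qcost f (qbuild ch l X e) <= I * (2 * #|candidates X e| * fuel.+2))%N.
Proof.
move=> /andP[/eqP sch och]; rewrite /qbuild qcost_bind /= addn0 -sch.
exact: qbuckets_cost.
Qed.

Lemma qbuild_empty ch l : is_chunk I ch ->
  qeval f (qbuild ch l set0 entry0) = entry0.
Proof.
move=> /andP[_ och]; rewrite /qbuild qeval_bind /candidates /= set0I.
by rewrite qbuckets_empty.
Qed.

Lemma levels_nil om : all (is_chunk I) om ->
  levels om entry0 [::] = nseq (size om) entry0.
Proof.
elim: om => //= ch om IH /andP[hch hom].
have -> : snapshot (size om) [::] = set0 :> {set V} by [].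
by rewrite qbuild_empty // IH.
Qed.

Lemma size_levels om e us : size (levels om e us) = size om.
Proof. by elim: om e => //= ch om IH e; rewrite IH. Qed.

Definition small_updates (us : seq (update V)) := {in us, forall u, small u.2}.

Lemma small_snapshot l us : small_updates us -> {in snapshot l us, forall v, small v}.
Proof. by move=> hus v /snapshot_mem[u /hus + <-]. Qed.

(** Level 0 is rebuilt at every update, and [min_good 0] is 1, so it leaves nothing over. *)
Lemma levels_last om e us : all (is_chunk I) om -> small_updates us -> entry_ok e ->
  (0 < size om)%N ->
  let e' := last e (levels om e us) in
  [/\ entry_ok e', snap e' = present us & rest e' = set0].
Proof.
move=> + hus; elim: om e => //= ch om IH e /andP[hch hom] he _.
have [sn ok rs] := qbuild_spec (size om) e hch (small_snapshot (l := size om) hus).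
case: om => [|ch' om] in IH hom sn ok rs *; last exact: (IH _ hom (ok he)).
rewrite /= in sn ok rs *; split; first exact: (ok he).
  by rewrite sn snapshot_rebuild // expn0 dvd1n.
by apply/eqP; rewrite -cards_eq0 -leqn0; move: rs; rewrite expn0 subnn !muln0.
Qed.

Definition chunk_comp := repeat_comp I (random_order R #|V| (enum V)).

Lemma chunk_comp_ok : AllLeaves f chunk_comp (is_chunk I).
Proof.
apply: AllLeaves_repeat; apply: random_order_perm; by rewrite -cardE.
Qed.

Lemma query_free_chunk : query_free f chunk_comp.
Proof. by apply: query_free_repeat; apply: query_free_random_order. Qed.

(** Induction from the top level down. Candidates of level [k] lie in its snapshot, of which at most
    [2 ^ k - 1] elements are absent now, whereas [min_good k] exceeds [q] times that number. The
    absent set is fixed before the orders are drawn, as the adversary is oblivious. *)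
Lemma levels_potential k (eps : R) e us : small_updates us -> 0 <= eps -> c <= eps * q%:R ->
  potential f (~: present us) eps (chosen e) <=
  Ex f (repeat_comp k chunk_comp) 0
    (fun _ om => potential f (~: present us) eps (chosen (last e (levels om e us)))).
Proof.
move=> hus eps0 ceps; set D := ~: _; elim: k e => [|k IH] e //.
rewrite Ex_repeatS; last exact: query_free_chunk.
pose X := snapshot k us; have hX := small_snapshot (l := k) hus.
have hC := small_candidates (e := e) (chosen e) hX.
have XD : #|candidates X e :&: D|%:R * c <= eps * (min_good k)%:R.
  have lt : (#|candidates X e :&: D| <= 2 ^ k - 1)%N.
    apply: leq_trans (snapshot_diff k us); apply/subset_leq_card/subsetP => v.
    by rewrite !inE => /andP[/andP[-> _] ->].
  apply: (@le_trans _ _ ((2 ^ k - 1)%:R * (eps * q%:R))).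
    apply: ler_pM => //; first by rewrite (le_trans ler01).
    by rewrite ler_nat.
  rewrite mulrCA ler_wpM2l // -natrM ler_nat /min_good mulnC; lia.
apply: le_trans (@qbuckets_potential I (min_good k) D eps _ _ set0 isT eps0 XD hC) _.
apply: (Ex_mono _ chunk_comp_ok) => _ ch hch.
have E : chosen (qeval f (qbuild ch k X e)) =
    (qeval f (qbuckets (min_good k) ch (chosen e) (candidates X e) set0)).1.
  by rewrite /qbuild qeval_bind.
rewrite -E; apply: le_trans (IH (qeval f (qbuild ch k X e))) _.
apply: (Ex_mono _ (AllLeaves_repeat k chunk_comp_ok)) => _ om /andP[/eqP som _] /=.
by rewrite som.
Qed.

(** Rebuilding level [l] costs at most [2 ^ l] times this. One factor 2 comes from [qphase_cost],
    the other from bounding candidates by the period [2 ^ l.+1] of the level above. *)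
Definition unit_cost : nat := (4 * I * fuel.+2 * (I * q + 1))%N.

(** Either the stored lower entries are correct, or a level above has just been rebuilt and all
    lower ones will be overwritten, since their periods divide its period. The size bound on [e]
    controls the candidates it hands down. *)
Lemma qupdate_spec om es e us u :
  let us' := rcons us u in
  all (is_chunk I) om -> small_updates us' ->
  es = levels om e us \/
    (size es = size om /\ forall l, (l < size om)%N -> (2 ^ l %| size us')%N) ->
  (#|rest e| + #|present us' :\: snap e| <= (I * q + 1) * 2 ^ size om)%N ->
  let Q := qupdate om es e (size us') (present us') in
  qeval f Q = levels om e us' /\
  (qcost f Q <= \sum_(l < size om) (2 ^ l %| size us')%N * (unit_cost * 2 ^ l))%N.
Proof.
move=> us' + hus; elim: om es e => [|ch om IH] es e; first by case: es.
case/andP=> hch hom hes hsz /=; rewrite big_ord_recr /=.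
case: es hes => [[//|[]//]|e1 es hes].
have step e' : e' = qeval f (qbuild ch (size om) (snapshot (size om) us') e) ->
    (#|rest e'| + #|present us' :\: snap e'| <= (I * q + 1) * 2 ^ size om)%N.
  move=> ->; have [-> _ rs] := qbuild_spec (size om) e hch (small_snapshot (l := size om) hus).
  have := snapshot_new (size om) us'; have : (0 < 2 ^ size om)%N by rewrite expn_gt0.
  nia.
case: ifP => d.
  rewrite qeval_bind qcost_bind; rewrite (snapshot_rebuild d) in step *.
  set e' := qeval f (qbuild _ _ _ _); rewrite qeval_bind qcost_bind /=.
  have [] := IH es e' hom _ (step e' erefl).
    right; split; first by case: hes => [/(congr1 size)|[]] /=; rewrite ?size_levels => -[].
    by move=> l ls; apply: dvdn_trans d; apply: dvdn_exp2l; apply: ltnW.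
  move=> -> hc; split=> //.
  rewrite addn0 mul1n addnC; apply: leq_add hc _.
  apply: leq_trans (qbuild_cost _ _ _ hch) _.
  have : (#|candidates (present us') e| <= (I * q + 1) * 2 ^ (size om).+1)%N.
    apply: leq_trans hsz; rewrite /candidates setIUr; apply: leq_trans (leq_card_setU _ _) _.
    by rewrite leq_add // ?setDE // subset_leq_card // subsetIr.
  rewrite /unit_cost expnS => h.
  apply: (@leq_trans (I * (2 * ((I * q + 1) * (2 * 2 ^ size om)) * fuel.+2))%N).
    by rewrite leq_mul2l leq_mul2r leq_mul2l h !orbT.
  apply: eq_leq; ring.
case: hes => [[E1 E2]|[_ /(_ (size om) (leqnn _))]]; last by rewrite d.
have e1E : e1 = qeval f (qbuild ch (size om) (snapshot (size om) us') e).
  by rewrite /us' snapshot_keep // -(size_rcons us u) d.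
rewrite qeval_bind qcost_bind /= !addn0 -e1E.
have [|-> hc] := IH es e1 hom _ (step _ e1E); last by [].
by left; rewrite E2 -E1.
Qed.

End Levels.

(** * Geometric scales *)

Section Scales.
Set Implicit Arguments.
Unset Strict Implicit.
Variables (R : realType) (N : nat).

Definition tau (j : int) : R := expR j%:~R.

Lemma tau_gt0 j : 0 < tau j. Proof. exact: expR_gt0. Qed.

Lemma tauD j (i : nat) : tau (j + i%:Z) = tau j * expR 1 ^+ i.
Proof. by rewrite /tau intrD expRD -expRM_natl mulr1. Qed.

Lemma ler_tau j k : (tau j <= tau k) = (j <= k).
Proof. by rewrite ler_expR ler_int. Qed.

(** Listed downwards, so that a search from the left meets the largest scale first. *)
Definition scales (x : R) : seq int := [seq Num.floor (ln x) - i%:Z | i <- iota 0 N].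

Lemma mem_scales x j : 0 < x ->
  (j \in scales x) = (tau j <= x < tau j * expR 1 ^+ N).
Proof.
move=> x0; rewrite -tauD -{2 3}(lnK x0) ler_expR ltr_expR.
rewrite -floor_ge_int -floor_lt_int /scales; move: (Num.floor (ln x)) => k.
apply/mapP/andP => [[i + ->]|[h1 h2]].
  by rewrite mem_iota /= add0n => iN; split; lia.
exists `|k - j|%N; last by lia.
by rewrite mem_iota /=; lia.
Qed.

Lemma floor_tau x : 0 < x ->
  tau (Num.floor (ln x)) <= x < tau (Num.floor (ln x)) * expR 1.
Proof.
move=> x0; rewrite -[expR 1]expr1 -tauD -{2 3}(lnK x0) ler_expR ltr_expR.
by rewrite -floor_ge_int -floor_lt_int; move: (Num.floor (ln x)) => k; lia.
Qed.

Lemma scales_uniq x : uniq (scales x).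
Proof.
by rewrite /scales; move: (Num.floor (ln x)) => k; rewrite map_inj_uniq ?iota_uniq // => i j; lia. Qed.

Lemma scales_sorted x : sorted (fun j k : int => k <= j) (scales x).
Proof.
rewrite /scales; move: (Num.floor (ln x)) => k; rewrite sorted_map; apply: (sub_sorted (e := ltn)); last exact: iota_ltn_sorted.
by move=> i j /=; lia.
Qed.

Lemma size_scales x : size (scales x) = N.
Proof. by rewrite size_map size_iota. Qed.

End Scales.

(** * Weights, costs and the optimum *)

Section Weights.
Set Implicit Arguments.
Unset Strict Implicit.
Variables (R : realType) (V : finType) (w : V -> R).
Hypothesis w_gt0 : forall v, 0 < w v.

Lemma le_wmax v : w v <= wmax w.
Proof. exact: le_bigmax. Qed.

Lemma wmin_le v : wmin w <= w v.
Proof. exact: bigmin_le. Qed.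

Lemma wmin_gt0 (v0 : V) : 0 < wmin w.
Proof. by apply: lt_bigmin => //; apply: lt_le_trans (le_wmax v0). Qed.

Lemma wmaxE (v0 : V) : wmax w = rho w * wmin w.
Proof. by rewrite /rho divfK // gt_eqF // wmin_gt0. Qed.

Lemma rho_ge1 (v0 : V) : 1 <= rho w.
Proof.
rewrite ler_pdivlMr ?mul1r; first exact: le_trans (wmin_le v0) (le_wmax v0).
exact: wmin_gt0.
Qed.

Lemma Cost_ge0 S : 0 <= Cost w S.
Proof. by apply: sumr_ge0 => v _; apply: ltW. Qed.

Lemma Cost_sub (S S' : {set V}) : S \subset S' -> Cost w S <= Cost w S'.
Proof.
move=> sS; rewrite /Cost [leRHS](big_setID S) /= (setIidPr sS) lerDl.
exact: Cost_ge0.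
Qed.

Lemma Cost_le_card S : Cost w S <= #|V|%:R * wmax w.
Proof.
apply: le_trans (_ : \sum_(v in S) wmax w <= _).
  by apply: ler_sum => v _; apply: le_wmax.
rewrite sumr_const -[wmax w *+ _]mulr_natl ler_wpM2r ?ler_nat ?max_card //.
by rewrite /wmax; elim/big_rec: _ => // v x _ x0; rewrite le_max x0 orbT.
Qed.

Lemma OPT_attained f (X : {set V}) :
  exists O : {set V}, [/\ O \subset X, f O = f X & OPT f w X = Cost w O].
Proof.
have [||O /andP[sO /eqP fO] E] := @eq_bigmin _ R _ (Cost w X) X
  (fun S => (S \subset X) && (f S == f X)) (Cost w).
- by rewrite subxx eqxx.
- by move=> S /andP[sS _]; apply: Cost_sub.
- by exists O.
Qed.

End Weights.

(** * The algorithm over all scales *)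

Section Algorithm.
Set Implicit Arguments.
Unset Strict Implicit.
Variables (R : realType) (V : finType) (w : V -> R) (eps : R) (N q : nat).

Local Notation e1 := (expR 1 : R).
Local Notation chunks := (seq (seq (seq V))).

(** Levels 0 to [2 * N]: with [#|V| < 2 ^ (2 * N)] the top level can take the whole present set as
    candidates. *)
Definition nlevels : nat := (2 * N).+1.
Definition beta (j : int) : R := tau R j * wmin w.

Definition relevant (m : R) (v : V) : seq int :=
  if 0 < m then scales N (m / w v) else [::].

Definition substate := (seq (update V) * seq (entry V))%type.
Definition state := (seq (update V) * (int -> substate))%type.

Definition qsubupdate (om : chunks) (u : update V) (j : int) (s : substate) :
    qprog R V substate :=
  let us := rcons s.1 u in
  qbind (qupdate w (tau R j) (beta j) e1 q (2 * N) om s.2 (entry0 V) (size us) (present us))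
    (fun es => QRet _ _ (us, es)).

Fixpoint qsubupdates (om : chunks) (u : update V) (js : seq int) (st : int -> substate) :
    qprog R V (int -> substate) :=
  if js is j :: js' then
    qbind (qsubupdate om u j (st j)) (fun s =>
      qsubupdates om u js' (fun k => if k == j then s else st k))
  else QRet _ _ st.

Definition solution (s : substate) : {set V} := chosen (last (entry0 V) s.2).

Fixpoint qselect (f0 F : R) (X : {set V}) (T : int -> {set V}) (js : seq int) :
    qprog R V {set V} :=
  if js is j :: js' then
    QAsk (T j) (fun r =>
      if (1 - eps) * F <= r - f0 then QRet _ _ (T j :&: X)
      else qselect f0 F X T js')
  else QRet _ _ set0.

Definition output_scales (F : R) : seq int :=
  if 0 < F then scales N (eps * F / wmin w) else [::].

Definition qhandle (om : chunks) (s : state) (u : update V) :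
    qprog R V (state * {set V}) :=
  QAsk set0 (fun f0 => QAsk (u.2 |: set0) (fun f1 =>
    qbind (qsubupdates om u (relevant (f1 - f0) u.2) s.2) (fun st =>
      let us := rcons s.1 u in
      QAsk (present us) (fun fX =>
        qbind (qselect f0 (fX - f0) (present us) (fun j => solution (st j))
                 (output_scales (fX - f0)))
          (fun S => QRet _ _ ((us, st), S)))))).

Definition init_state : state := ([::], fun=> ([::], nseq nlevels (entry0 V))).

(** The seed is drawn at the first update, whence the [option], and is carried along unchanged. *)
Definition handle (s : option (chunks * state)) (u : update V) :
    Comp R V (option (chunks * state) * {set V}) :=
  let continue om s :=
    bind (qcomp (qhandle om s u)) (fun p => Ret _ _ (Some (om, p.1), p.2)) in
  if s is Some (om, s) then continue om s
  else bind (repeat_comp nlevels (chunk_comp R V (2 * N))) (fun om => continue om init_state).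

(** * Cost and value of the output for a fixed seed *)

Variable f : {set V} -> R.
Hypotheses (f_ge0 : forall A, 0 <= f A) (fmono : monotone_setfun f) (fsub : submodular f).
Hypothesis w_gt0 : forall v, 0 < w v.
Hypotheses (eps_gt0 : 0 < eps) (eps_lt1 : eps < 1).
Hypothesis v0 : V.
Hypothesis N_gt0 : (0 < N)%N.
Hypothesis N_large : #|V|%:R * rho w / eps * e1 <= e1 ^+ N.
Hypothesis card_V : (#|V| < 2 ^ (2 * N))%N.
Hypothesis q_large : e1 <= eps / (2 * N)%:R * q%:R.

Local Notation gain0 v := (gain f set0 v).

(** Membership depends only on the gain over the empty set, neither on time nor on the seed; each
    scale thus sees a fixed subsequence of updates. *)
Definition domain (j : int) : {set V} := [set v | j \in relevant (gain0 v) v].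

Definition relevant_updates (j : int) (us : seq (update V)) :=
  [seq u <- us | u.2 \in domain j].

Definition sublevels (om : chunks) (us : seq (update V)) (j : int) : seq (entry V) :=
  levels w (tau R j) (beta j) e1 q (2 * N) f om (entry0 V) (relevant_updates j us).

Definition Tset om us j : {set V} := chosen (last (entry0 V) (sublevels om us j)).

Let F us := f (present us) - f set0.

Fixpoint select (F : R) (X : {set V}) (T : int -> {set V}) (js : seq int) : {set V} :=
  if js is j :: js' then
    if (1 - eps) * F <= f (T j) - f set0 then T j :&: X else select F X T js'
  else set0.

Definition output om us : {set V} :=
  select (F us) (present us) (Tset om us) (output_scales (F us)).

Let e1_gt0 : 0 < e1. Proof. exact: expR_gt0. Qed.
Let e1_ge1 : 1 <= e1. Proof. by apply: le_trans (expR_ge1Dx 1); rewrite lerDl. Qed.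
Let wmin0 : 0 < wmin w. Proof. exact: (wmin_gt0 w_gt0 v0). Qed.
Let beta0 j : 0 < beta j. Proof. by rewrite mulr_gt0 ?tau_gt0. Qed.

Let beta_tau j v : beta j <= tau R j * w v.
Proof. by rewrite ler_pM2l ?tau_gt0 // wmin_le. Qed.

Let F_ge0 us : 0 <= F us. Proof. by rewrite subr_ge0 fmono // sub0set. Qed.

Lemma mem_relevant j v :
  (j \in relevant (gain0 v) v) =
  [&& 0 < gain0 v, tau R j * w v <= gain0 v & gain0 v < tau R j * w v * e1 ^+ N].
Proof.
rewrite /relevant; case: ifP => g0 /=; last by rewrite in_nil.
rewrite mem_scales ?divr_gt0 // ler_pdivlMr // ltr_pdivrMr //.
by rewrite mulrAC.
Qed.

Lemma rho_le : rho w <= e1 ^+ N.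
Proof.
have n1 : 1 <= #|V|%:R :> R by rewrite ler1n -cardsT; apply/card_gt0P; exists v0; rewrite inE.
have i1 : 1 <= eps^-1 by rewrite invf_ge1 // ltW.
have r0 : 0 <= rho w by rewrite (le_trans ler01) // rho_ge1.
have nr0 : 0 <= #|V|%:R * rho w by rewrite mulr_ge0.
apply: le_trans N_large; apply: (@le_trans _ _ (#|V|%:R * rho w / eps)).
  by apply: (@le_trans _ _ (#|V|%:R * rho w)); rewrite ?ler_peMl ?ler_peMr.
by rewrite ler_peMr // divr_ge0 // ltW.
Qed.

(** One factor [e1 ^+ N] comes from relevance, the other from [w v <= rho w * wmin w] and [rho_le];
    hence [2 * N] buckets. *)
Lemma domain_small j v : v \in domain j -> small (beta j) e1 f (2 * N) v.
Proof.
rewrite inE mem_relevant => /and3P[_ _ h]; rewrite /small; apply: lt_le_trans h _.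
have -> : beta j * e1 ^+ (2 * N) = tau R j * (e1 ^+ N * wmin w) * e1 ^+ N.
  by rewrite mul2n -addnn exprD /beta; ring.
rewrite ler_pM2r ?exprn_gt0 // ler_pM2l ?tau_gt0 //.
apply: le_trans (le_wmax w v) _; rewrite (wmaxE w_gt0 v0).
by rewrite ler_pM2r // rho_le.
Qed.

Lemma relevant_small j us : small_updates (beta j) e1 f (2 * N) (relevant_updates j us).
Proof. by move=> u; rewrite mem_filter => /andP[/domain_small]. Qed.

Lemma present_relevant j us : present (relevant_updates j us) = present us :&: domain j.
Proof. exact: present_filter. Qed.

Definition seed_ok (om : chunks) := (size om == nlevels) && all (is_chunk (2 * N)) om.

Lemma Tset_spec om us j : seed_ok om ->
  dense w (tau R j) f (Tset om us j) /\
  {in present us :&: domain j, forall v, gain f (Tset om us j) v < tau R j * w v}.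
Proof.
move=> /andP[/eqP som oom].
have [||ok sn rs] := @levels_last _ _ w (tau R j) (beta j) e1 q (2 * N) f fmono fsub (beta0 j)
  e1_ge1 (beta_tau j) card_V (2 * N) om (entry0 V) _ oom (relevant_small (j := j) (us := us)).
- exact: entry0_ok.
- by rewrite som.
case: ok => d h; split=> // v; rewrite -present_relevant -sn => /h.
by rewrite rs inE => -[].
Qed.

Lemma select_spec G X T js k : sorted (fun i j : int => j <= i) js -> k \in js ->
  (1 - eps) * G <= f (T k) - f set0 ->
  exists j, [/\ j \in js, k <= j, (1 - eps) * G <= f (T j) - f set0 &
                select G X T js = T j :&: X].
Proof.
elim: js => //= j js IH sj; rewrite inE => kj hk.
have kle : k <= j.
  case/orP: kj => [/eqP -> //|kjs].
  have tr : transitive (fun i j : int => j <= i) by move=> a b c' ab bc; apply: le_trans bc ab.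
  by have /allP/(_ _ kjs) := order_path_min tr sj.
case: ifP => hj; first by exists j; rewrite mem_head.
case/orP: kj hk => [/eqP -> |kjs] hk; first by rewrite hk in hj.
have [j' [h1 h2 h3 h4]] := IH (path_sorted sj) kjs hk.
by exists j'; rewrite inE h1 orbT.
Qed.

Definition loss om us j := f (Tset om us j) - f (Tset om us j :&: present us).

Lemma loss_ge0 om us j : 0 <= loss om us j.
Proof. by rewrite subr_ge0 fmono // subsetIl. Qed.

Lemma cover_gain T (O : {set V}) t : {in O, forall v, gain f T v <= t * w v} ->
  f (T :|: O) - f T <= t * Cost w O.
Proof.
move: {2}#|O| (erefl #|O|) => n; elim: n O => [|n IH] O.
  by move=> /cards0_eq -> _; rewrite setU0 subrr /Cost big_set0 mulr0.
move=> cO hO; have /card_gt0P[v vO] : (0 < #|O|)%N by rewrite cO.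
have cO' : #|O :\ v| = n by move: cO; rewrite (cardsD1 v) vO => -[].
have hO' : {in O :\ v, forall u, gain f T u <= t * w u}.
  by move=> u; rewrite inE => /andP[_]; apply: hO.
have := IH _ cO' hO'; rewrite {2}/Cost (big_setD1 v vO) /= -/(Cost w _) mulrDr => H.
have g := gain_anti fmono fsub v (subsetUl T (O :\ v)).
have := hO _ vO; have -> : f (T :|: O) = f (T :|: O :\ v) + gain f (T :|: O :\ v) v.
  by rewrite /gain setUCA setD1K //; ring.
lra.
Qed.

Lemma optimal_scale om us : seed_ok om -> 0 < F us ->
  exists k, [/\ k \in output_scales (F us),
    (1 - eps) * F us <= f (Tset om us k) - f set0 &
    eps * F us < tau R k * e1 * OPT f w (present us)].
Proof.
move=> oom F0; have [O [sO fO ->]] := OPT_attained w_gt0 f (present us).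
have O0 : O != set0 by apply: contraTneq F0 => O0; rewrite /F -fO O0 subrr ltxx.
have [v vO] := set0Pn _ O0.
have wO : wmin w <= Cost w O.
  apply: le_trans (wmin_le w v) _; rewrite /Cost (big_setD1 v vO) /= lerDl.
  exact: Cost_ge0.
have CO : 0 < Cost w O by apply: lt_le_trans wO.
have CO' : Cost w O * e1 <= eps * wmin w * e1 ^+ N.
  apply: le_trans (_ : #|V|%:R * wmax w * e1 <= _).
    by rewrite ler_pM2r // Cost_le_card.
  rewrite (wmaxE w_gt0 v0) (_ : _ * e1 = eps * wmin w * (#|V|%:R * rho w / eps * e1)).
    by rewrite ler_pM2l // mulr_gt0.
  by field; rewrite gt_eqF.
have x0 : 0 < eps * F us / Cost w O by rewrite divr_gt0 ?mulr_gt0.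
(* The largest [k] with [tau R k * Cost w O <= eps * F us]. *)
set k := Num.floor (ln (eps * F us / Cost w O)).
have /andP[] := floor_tau x0; rewrite -/k ler_pdivlMr // ltr_pdivrMr // => k1 k2.
have t0 := tau_gt0 R k.
(* Since [gain0 u <= F us] for present [u], no present element is too dense for scale [k]; those
   outside its domain have gain below [tau R k * w u]. *)
have up : F us < tau R k * (wmin w * e1 ^+ N).
  rewrite -(ltr_pM2l eps_gt0); apply: lt_le_trans k2 _.
  rewrite [leRHS]mulrCA -mulrA ler_pM2l //; move: CO'; rewrite mulrC; lra.
exists k; split=> //.
  rewrite /output_scales F0 mem_scales ?divr_gt0 ?mulr_gt0 //.
  rewrite ler_pdivlMr // ltr_pdivrMr //; apply/andP; split.
    by apply: le_trans k1; rewrite ler_pM2l.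
  apply: (@lt_trans _ _ (F us)); first by rewrite gtr_pMl.
  by apply: lt_le_trans up _; rewrite mulrA mulrAC.
have [_ hT] := Tset_spec us k oom; set T := Tset _ _ _ in hT *.
have hO : {in O, forall v, gain f T v <= tau R k * w v}.
  move=> u uO; have uX := subsetP sO _ uO.
  have [ud|ud] := boolP (u \in domain k); first by apply/ltW/hT; rewrite inE uX.
  have gT : gain f T u <= gain0 u by apply: gain_anti => //; apply: sub0set.
  have gF : gain0 u <= F us.
    by rewrite /gain lerB // fmono // setU0 sub1set.
  apply: le_trans gT _; move: ud; rewrite inE mem_relevant !negb_and -!leNgt -ltNge.
  have tw : 0 < tau R k * w u by rewrite mulr_gt0.
  case/or3P => [g|/ltW //|g]; first lra.
  exfalso; move: up; rewrite ltNge => /negP; apply; apply: le_trans gF; apply: le_trans g.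
  by rewrite mulrA ler_pM2r ?exprn_gt0 // ler_pM2l // wmin_le.
have := cover_gain hO; have : f O <= f (T :|: O) by rewrite fmono // subsetUr.
rewrite fO mulrBl mul1r; move: k1; rewrite /F; lra.
Qed.

Lemma output_sub om us : output om us \subset present us.
Proof.
rewrite /output; elim: (output_scales _) => [|j js IH] /=; first exact: sub0set.
by case: ifP => // _; apply: subsetIr.
Qed.

(** The chosen scale [j] is at least the [k] of [optimal_scale], and density of the surviving part
    gives [tau R j * Cost w S <= F us]. *)
Lemma output_cost om us : seed_ok om ->
  Cost w (output om us) <= e1 / eps * OPT f w (present us).
Proof.
move=> oom; have := F_ge0 us; rewrite le_eqVlt => /orP[/eqP F0|F0].
  rewrite /output /output_scales -F0 ltxx /= {1}/Cost big_set0.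
  have [O [_ _ ->]] := OPT_attained w_gt0 f (present us).
  by rewrite mulr_ge0 ?divr_ge0 ?Cost_ge0 // ltW.
have [k [kJ hk1 hk2]] := optimal_scale oom F0.
have so : sorted (fun i j : int => j <= i) (output_scales (F us)).
  by rewrite /output_scales; case: ifP => // _; apply: scales_sorted.
have [j [_ kj _ E]] := select_spec (present us) so kJ hk1; rewrite /output E.
have [dT _] := Tset_spec us j oom.
have h := dT _ (subsetIl _ (present us)).
have h2 : f (Tset om us j :&: present us) - f set0 <= F us.
  by rewrite /F lerB // fmono // subsetIr.
have tkj : tau R k <= tau R j by rewrite ler_tau.
have t0 := tau_gt0 R k.
set S := _ :&: _ in h h2 *; set Y := OPT _ _ _ in hk2 *.
rewrite mulrAC ler_pdivlMr //.
rewrite -(ler_pM2l t0).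
apply: le_trans (_ : eps * F us <= _); last by rewrite mulrA ltW.
rewrite mulrA mulrC ler_pM2l //; apply: le_trans h2; apply: le_trans h.
by rewrite ler_wpM2r // Cost_ge0.
Qed.

(** The chosen scale depends on the seed, so its loss is bounded by the sum over all output scales,
    a list determined by the updates alone. *)
Lemma output_value om us : seed_ok om ->
  f set0 + (1 - eps) * F us - \sum_(j <- output_scales (F us)) loss om us j <=
  f (output om us).
Proof.
move=> oom; have := F_ge0 us; rewrite le_eqVlt => /orP[/eqP F0|F0].
  by rewrite /output /output_scales -F0 ltxx /= big_nil mulr0 subr0 addr0.
have [k [kJ hk1 hk2]] := optimal_scale oom F0.
have so : sorted (fun i j : int => j <= i) (output_scales (F us)).
  by rewrite /output_scales; case: ifP => // _; apply: scales_sorted.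
have [j [jJ kj hj E]] := select_spec (present us) so kJ hk1.
rewrite /output E (big_rem j) //=.
have : 0 <= \sum_(i <- rem j (output_scales (F us))) loss om us i.
  by apply: sumr_ge0 => i _; apply: loss_ge0.
have lE : loss om us j = f (Tset om us j) - f (Tset om us j :&: present us) by [].
move: hj; set G := F us; lra.
Qed.

(** * Expected value over the seed *)

Definition seed_comp := repeat_comp nlevels (chunk_comp R V (2 * N)).

Lemma seed_comp_ok : AllLeaves f seed_comp seed_ok.
Proof. exact: AllLeaves_repeat (chunk_comp_ok f (2 * N)). Qed.

(** The potential starts at [d * f set0]. Bounding [f T] by [f (present us)] plus the loss gives
    [(1 - d) * E <= d * F us], and [d <= 1/2] turns this into [E <= 2 * d * F us]. *)
Lemma expected_loss us j :
  Ex f seed_comp 0 (fun _ om => loss om us j) <= eps / N%:R * F us.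
Proof.
set d := eps / (2 * N)%:R.
have N1 : 1 <= N%:R :> R by rewrite ler1n.
have d0 : 0 <= d by rewrite divr_ge0 // ltW.
have d2 : d <= 2^-1.
  rewrite /d natrM ler_pdivrMr; last by rewrite mulr_gt0 // ltr0n.
  by rewrite mulKf ?pnatr_eq0 // (le_trans (ltW eps_lt1)).
have := @levels_potential _ _ w (tau R j) (beta j) e1 q (2 * N) f fmono fsub (beta0 j)
  e1_ge1 card_V (2 * N) nlevels d (entry0 V) _ (relevant_small (j := j) (us := us))
  d0 q_large.
rewrite {1}/potential /= set0D subrr subr0 => H.
have : d * f set0 <= Ex f seed_comp 0 (fun _ om => d * (f set0 + F us) + (d - 1) * loss om us j).
  apply: le_trans H _; apply: (Ex_mono _ (AllLeavesT f _)) => _ om _.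
  rewrite -/(sublevels om us j) -/(Tset om us j) /potential present_relevant.
  set T := Tset _ _ _; rewrite setDE setCK /loss -/T.
  have h1 : f (T :&: (present us :&: domain j)) <= f (T :&: present us).
    by rewrite fmono // setIA subsetIl.
  have h2 : f (T :&: present us) <= f (present us) by rewrite fmono // subsetIr.
  have h3 : d * f (T :&: present us) <= d * f (present us) by rewrite ler_wpM2l.
  have -> : f set0 + F us = f (present us) by rewrite /F; ring.
  rewrite mulrBl mul1r mulrBr; lra.
rewrite Ex_add Ex_const Ex_scale; set E := Ex _ _ _ _ => H2.
have E0 : 0 <= E.
  rewrite -(Ex_const f seed_comp 0 0); apply: (Ex_mono _ (AllLeavesT f _)) => _ om _.
  exact: loss_ge0.
have -> : eps / N%:R = 2 * d by rewrite /d natrM; field; rewrite pnatr_eq0 -lt0n.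
have : d * E <= 2^-1 * E by apply: ler_wpM2r.
move: H2; rewrite mulrDr mulrBl mul1r; lra.
Qed.

(** One [eps] is the tolerance of the selection test, the other the total of at most [N] expected
    losses. *)
Lemma expected_output_value us :
  (1 - 2 * eps) * f (present us) <= Ex f seed_comp 0 (fun _ om => f (output om us)).
Proof.
apply: (@le_trans _ _ (Ex f seed_comp 0 (fun _ om => f set0 + (1 - eps) * F us
    + (-1) * \sum_(j <- output_scales (F us)) loss om us j))); last first.
  apply: (Ex_mono _ seed_comp_ok) => _ om oom.
  by rewrite mulN1r; apply: output_value.
rewrite Ex_add Ex_const Ex_scale Ex_sum.
have : \sum_(j <- output_scales (F us)) Ex f seed_comp 0 (fun _ om => loss om us j) <= eps * F us.
  apply: le_trans (_ : \sum_(j <- output_scales (F us)) eps / N%:R * F us <= _).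
    by apply: ler_sum => j _; apply: expected_loss.
  rewrite big_const_seq count_predT iter_addr addr0 /output_scales.
  case: ifP => _; last by rewrite mulr0n mulr_ge0 // ltW.
  by rewrite size_scales -[leLHS]mulr_natr mulrAC divfK // pnatr_eq0 -lt0n.
have : 0 <= eps * f set0 by rewrite mulr_ge0 // ltW.
rewrite /F; have := f_ge0 set0; nra.
Qed.

(** * Amortized number of queries *)

Let lcost := unit_cost q (2 * N) (2 * N).

Definition rebuild_cost (t : nat) : nat :=
  \sum_(l < nlevels) (2 ^ l %| t) * (lcost * 2 ^ l).

Lemma relevant_updates_rcons j us u : relevant_updates j (rcons us u) =
  if u.2 \in domain j then rcons (relevant_updates j us) u else relevant_updates j us.
Proof. exact: filter_rcons. Qed.

Lemma qsubupdate_spec om us u j : seed_ok om -> u.2 \in domain j ->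
  let us' := rcons us u in
  let Q := qsubupdate om u j (relevant_updates j us, sublevels om us j) in
  qeval f Q = (relevant_updates j us', sublevels om us' j) /\
  (qcost f Q <= rebuild_cost (size (relevant_updates j us')))%N.
Proof.
move=> /andP[/eqP som oom] ud us' Q.
have rE : relevant_updates j us' = rcons (relevant_updates j us) u.
  by rewrite relevant_updates_rcons ud.
have hsz : (#|rest (entry0 V)| + #|present (relevant_updates j us') :\: snap (entry0 V)|
    <= (2 * N * q + 1) * 2 ^ size om)%N.
  rewrite cards0 add0n setD0 som; apply: leq_trans (max_card _) _.
  apply: leq_trans (ltnW card_V) _; rewrite -[leqLHS]mul1n; apply: leq_mul.
    by rewrite addn1.
  by rewrite leq_exp2l.
have hs := relevant_small (j := j) (us := us').
rewrite rE in hsz hs.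
have [] := @qupdate_spec _ _ w (tau R j) (beta j) e1 q (2 * N) f fmono fsub (beta0 j)
  e1_ge1 (beta_tau j) card_V (2 * N) om (sublevels om us j) (entry0 V)
  (relevant_updates j us) u oom hs (or_introl erefl) hsz.
rewrite /Q /qsubupdate qeval_bind qcost_bind /= => -> hc.
split; first by rewrite /sublevels rE.
by rewrite addn0 /rebuild_cost -som rE.
Qed.

Lemma qsubupdates_spec om us u js st : seed_ok om -> uniq js ->
  (forall j, j \in js -> u.2 \in domain j) ->
  (forall j, j \in js -> st j = (relevant_updates j us, sublevels om us j)) ->
  let us' := rcons us u in
  let Q := qsubupdates om u js st in
  (forall j, qeval f Q j =
     if j \in js then (relevant_updates j us', sublevels om us' j) else st j) /\
  (qcost f Q <= \sum_(j <- js) rebuild_cost (size (relevant_updates j us')))%N.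
Proof.
move=> oom; elim: js st => [|j js IH] st //= /andP[jjs ujs] hd hst.
rewrite qeval_bind qcost_bind big_cons hst ?mem_head //.
have [-> hc] := qsubupdate_spec us oom (hd j (mem_head _ _)).
set st' := fun k => _.
have [||h1 h2] := IH st' ujs.
- by move=> k kjs; apply: hd; rewrite inE kjs orbT.
- move=> k kjs; rewrite /st' ifN; first by apply: hst; rewrite inE kjs orbT.
  by apply: contraNneq jjs => <-.
split; last exact: leq_add.
move=> k; rewrite h1 inE /st'; case: (eqVneq k j) => [->|] //=.
by rewrite (negPf jjs).
Qed.

Definition state_ok om us (s : state) :=
  s.1 = us /\ forall j, s.2 j = (relevant_updates j us, sublevels om us j).

Lemma init_state_ok om : seed_ok om -> state_ok om [::] init_state.
Proof.
move=> /andP[/eqP som oom]; split=> // j.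
by rewrite /sublevels /relevant_updates /= (@levels_nil _ _ _ _ _ _ _ _ _ fmono fsub _ _ _ (2 * N)) ?som.
Qed.

Lemma qselect_eval G X T T' js : (forall j, T j = T' j) ->
  qeval f (qselect (f set0) G X T js) = select G X T' js /\
  (qcost f (qselect (f set0) G X T js) <= size js)%N.
Proof.
move=> TT'; elim: js => //= j js [IH1 IH2]; by rewrite -TT'; case: ifP.
Qed.

(* [handle] keeps a structure for every integer scale; only these ever change. *)
Definition all_scales : seq int :=
  undup (flatten [seq relevant (gain0 v) v | v <- enum V]).

Lemma relevant_uniq m v : uniq (relevant m v).
Proof. by rewrite /relevant; case: ifP => // _; apply: scales_uniq. Qed.

Lemma size_relevant m v : (size (relevant m v) <= N)%N.
Proof. by rewrite /relevant; case: ifP => // _; rewrite size_scales. Qed.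

Lemma relevant_all v j : j \in relevant (gain0 v) v -> j \in all_scales.
Proof.
move=> h; rewrite mem_undup; apply/flatten_mapP; exists v => //.
by rewrite mem_enum.
Qed.

Lemma sum_relevant v (F' : int -> nat) :
  (\sum_(j <- all_scales) (v \in domain j) * F' j = \sum_(j <- relevant (gain0 v) v) F' j)%N.
Proof.
rewrite (eq_bigr (fun j => if v \in domain j then F' j else 0%N)); last first.
  by move=> j _; case: ifP => _; rewrite ?mul1n ?mul0n.
rewrite -big_mkcond -big_filter; apply: perm_big; apply: uniq_perm.
- by rewrite filter_uniq // undup_uniq.
- exact: relevant_uniq.
move=> j; rewrite mem_filter inE; apply/andb_idr; exact: relevant_all.
Qed.

(* [t %/ 2 ^ l] is the number of rebuilds of level [l] up to time [t]. *)
Definition paid1 (t : nat) : nat := \sum_(l < nlevels) (t %/ 2 ^ l) * (lcost * 2 ^ l).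

Lemma paid1S t : paid1 t.+1 = (paid1 t + rebuild_cost t.+1)%N.
Proof.
rewrite /paid1 /rebuild_cost -big_split /=; apply: eq_bigr => l _.
by rewrite divnS ?expn_gt0 // mulnDl addnC.
Qed.

(** Rebuilds that are [2 ^ l] times dearer are [2 ^ l] times rarer, so each level contributes at
    most [lcost * t]. *)
Lemma paid1_le t : (paid1 t <= nlevels * lcost * t)%N.
Proof.
apply: (@leq_trans (\sum_(l < nlevels) lcost * t)%N).
  by apply: leq_sum => l _; rewrite mulnCA leq_mul2l leq_divM orbT.
by rewrite sum_nat_const card_ord mulnA.
Qed.

Definition paid us : nat := \sum_(j <- all_scales) paid1 (size (relevant_updates j us)).

Lemma paid_rcons us u : paid (rcons us u) =
  (paid us + \sum_(j <- relevant (gain0 u.2) u.2)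
     rebuild_cost (size (relevant_updates j (rcons us u))))%N.
Proof.
rewrite -sum_relevant /paid -big_split /=; apply: eq_bigr => j _.
rewrite relevant_updates_rcons; case: ifP => _; last by rewrite mul0n addn0.
by rewrite size_rcons paid1S mul1n.
Qed.

(** Each update is relevant to at most [N] scales, so the lengths of all relevant subsequences add
    up to at most [N * size us]. *)
Lemma paid_le us : (paid us <= nlevels * lcost * N * size us)%N.
Proof.
apply: (@leq_trans (\sum_(j <- all_scales) nlevels * lcost * size (relevant_updates j us))%N).
  by apply: leq_sum => j _; apply: paid1_le.
rewrite -big_distrr /= -[leqRHS]mulnA leq_mul2l; apply/orP; right.
elim: us => [|u us IH]; first by rewrite big1.
rewrite /= mulnS; apply: leq_trans (_ : _ <=
  \sum_(j <- all_scales) ((u.2 \in domain j) * 1 + size (relevant_updates j us)))%N _.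
  by apply: leq_sum => j _; case: ifP.
rewrite big_split /= sum_relevant; apply: leq_add IH.
by rewrite sum1_size size_relevant.
Qed.

Lemma size_output_scales G : (size (output_scales G) <= N)%N.
Proof. by rewrite /output_scales; case: ifP => // _; rewrite size_scales. Qed.

(** The increase of [paid] covers the rebuilds. Beyond it there are two queries for the gain of the
    updated element, one for the present set and at most [N] for the selection. *)
Lemma qhandle_spec om us s u : seed_ok om -> state_ok om us s ->
  let Q := qhandle om s u in
  [/\ state_ok om (rcons us u) (qeval f Q).1, (qeval f Q).2 = output om (rcons us u) &
      (qcost f Q + paid us <= paid (rcons us u) + (N + 3))%N].
Proof.
move=> oom [s1 s2] Q; rewrite /Q /= qeval_bind qcost_bind s1 -/(gain f set0 u.2) /=.
have [||h1 h2] := @qsubupdates_spec om us u (relevant (gain0 u.2) u.2) s.2 oom (relevant_uniq _ _).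
- by move=> j; rewrite inE.
- by move=> j _.
set st := qeval f (qsubupdates _ _ _ _) in h1 *.
have hst j : st j = (relevant_updates j (rcons us u), sublevels om (rcons us u) j).
  rewrite h1; case: ifPn => // jr.
  by rewrite s2 /sublevels relevant_updates_rcons inE (negPf jr).
have [|e c] := @qselect_eval (F (rcons us u)) (present (rcons us u)) (fun j => solution (st j))
  (Tset om (rcons us u)) (output_scales (F (rcons us u))).
  by move=> j; rewrite /solution hst.
rewrite qeval_bind qcost_bind /= -/(F _) e; split=> //.
rewrite addn0; have := size_output_scales (F (rcons us u)).
move: c h2; rewrite paid_rcons.
move: (qcost _ (qselect _ _ _ _ _)) (qcost _ (qsubupdates _ _ _ _)) (size (output_scales _)).
by move: (\sum_(j <- _) _)%N (paid us) => a b x y z; lia.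
Qed.

(** * Whole runs: deterministic given the seed, then averaged over it *)

Lemma run_spec om us us' s S : seed_ok om -> state_ok om us s ->
  exists n : nat,
  let S' := if us' is [::] then S else output om (us ++ us') in
  [/\ (n + paid us <= paid (us ++ us') + size us' * (N + 3))%N,
      forall m h, Ex f (run handle (Some (om, s)) us' S) m h = h (m + n)%N S' &
      forall P : {set V} -> Prop, P S' ->
        AllLeaves f (run handle (Some (om, s)) us' S) P].
Proof.
move=> oom; elim: us' us s S => [|u us' IH] us s S hs.
  by exists 0%N; split=> [|m h|P PS] //=; rewrite ?cats0 ?addn0.
have [hs' out cost] := qhandle_spec u oom hs.
set Q := qhandle om s u in hs' out cost.
have [n [hn hE hA]] := IH (rcons us u) _ (qeval f Q).2 hs'.
have E : (if us' is [::] then (qeval f Q).2 else output om (rcons us u ++ us')) =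
    output om (us ++ u :: us').
  rewrite -cat_rcons; case: (us') => //; by rewrite cats0.
rewrite E in hE hA; exists (qcost f Q + n)%N; split.
- move: hn cost; rewrite -cat_rcons /= mulSn; move: (size us' * _)%N (paid (_ ++ _)).
  by move: (qcost f Q) (paid us) (paid (rcons us u)) => a b x y z; lia.
- by move=> m h; rewrite /= !Ex_bind Ex_qcomp /= hE addnA !addnS !addSn.
- move=> P PS; rewrite /=; apply/AllLeaves_bind/AllLeaves_bind.
  by apply/AllLeaves_qcomp => /=; apply: hA.
Qed.

(** The seed, drawn inside the first update, is moved in front of the run; hence at least one
    update. *)
Lemma run_Ex us h : (0 < size us)%N ->
  Ex f (run handle None us set0) 0 h =
  Ex f seed_comp 0 (fun m om => Ex f (run handle (Some (om, init_state)) us set0) 0 h).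
Proof.
case: us => // u us _; transitivity (Ex f (bind
  (bind seed_comp (fun om => handle (Some (om, init_state)) u))
  (fun p => run handle p.1 us p.2)) 0 h); first by [].
have qf : query_free f seed_comp := query_free_repeat nlevels (@query_free_chunk R V f (2 * N)).
rewrite Ex_bind Ex_bind [LHS]qf.
by apply: (Ex_ext _ (AllLeavesT f seed_comp)) => _ om _; rewrite -Ex_bind.
Qed.

Lemma run_AllLeaves us P : (0 < size us)%N ->
  (forall om, seed_ok om -> AllLeaves f (run handle (Some (om, init_state)) us set0) P) ->
  AllLeaves f (run handle None us set0) P.
Proof.
case: us => // u us _ h; apply/AllLeaves_bind/AllLeaves_bind.
by apply: AllLeaves_imp seed_comp_ok => om /h /AllLeaves_bind.
Qed.

Theorem handle_correct us : (0 < size us)%N ->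
  let X := present us in
  let c := run handle None us set0 in
  [/\ (1 - 2 * eps) * f X <= Ex f c 0 (fun _ S => f S),
      AllLeaves f c (fun S => S \subset X /\ Cost w S <= e1 / eps * OPT f w X) &
      Ex f c 0 (fun m _ => m%:R) <=
        (size us)%:R * (nlevels * lcost * N + (N + 3))%:R].
Proof.
move=> us0 X c; have S'E om : (if us is [::] then set0 else output om ([::] ++ us)) = output om us.
  by case: (us) us0.
split.
- rewrite /c run_Ex //; apply: le_trans (expected_output_value us) _.
  apply: (Ex_mono _ seed_comp_ok) => _ om oom.
  have [n [_ hE _]] := run_spec us set0 oom (init_state_ok oom).
  by rewrite hE S'E.
- apply: run_AllLeaves => // om oom.
  have [n [_ _ hA]] := run_spec us set0 oom (init_state_ok oom).
  by apply: hA; rewrite S'E; split; [apply: output_sub|apply: output_cost].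
- rewrite /c run_Ex // -(Ex_const f seed_comp 0 (_ * _)).
  apply: (Ex_mono _ seed_comp_ok) => _ om oom.
  have [n [hn hE _]] := run_spec us set0 oom (init_state_ok oom).
  rewrite hE add0n -natrM ler_nat; apply: leq_trans (leq_addr _ _) (leq_trans hn _).
  by rewrite [leqRHS]mulnDr leq_add2r [leqRHS]mulnC; exact: paid_le.
Qed.

End Algorithm.

(** * Choice of the constants *)

Lemma expR1_le4 (R : realType) : expR 1 <= 4 :> R.
Proof.
have h : 2^-1 <= expR (- 2^-1) :> R by apply: le_trans (expR_ge1Dx _); lra.
rewrite expRN lef_pV2 ?posrE ?expR_gt0 // in h.
have -> : 1 = 2^-1 + 2^-1 :> R by lra.
rewrite expRD; apply: (@le_trans _ _ (2 * 2)); last lra.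
by apply: ler_pM => //; apply: expR_ge0.
Qed.

Lemma query_bound (N q0 : nat) : (0 < N)%N -> (0 < q0)%N ->
  (nlevels N * unit_cost (q0 * N ^ 2) (2 * N) (2 * N) * N + (N + 3) <= 292 * q0 * N ^ 7)%N.
Proof.
move=> N0 q00; rewrite /nlevels /unit_cost.
have h1 : ((2 * N).+1 <= 3 * N)%N by lia.
have h2 : ((2 * N).+2 <= 4 * N)%N by lia.
have h3 : (2 * N * (q0 * N ^ 2) + 1 <= 3 * (q0 * N ^ 3))%N.
  have : (0 < q0 * N ^ 3)%N by rewrite muln_gt0 q00 expn_gt0 N0.
  have -> : (2 * N * (q0 * N ^ 2) = 2 * (q0 * N ^ 3))%N by rewrite !expnS expn0; lia.
  lia.
have h4 : (N + 3 <= 4 * q0 * N ^ 7)%N.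
  apply: (@leq_trans (4 * N)); first lia.
  apply: (@leq_trans (4 * q0 * N)); first by rewrite leq_mul2r leq_pmulr ?orbT.
  by rewrite leq_mul2l -{1}(expn1 N) leq_pexp2l ?orbT.
(* [292 = 3 * 4 * 2 * 4 * 3 + 4], the last summand being for [h4]. *)
have -> : (292 * q0 * N ^ 7 = 3 * N * (4 * (2 * N) * (4 * N) * (3 * (q0 * N ^ 3))) * N
    + 4 * q0 * N ^ 7)%N by ring.
apply: leq_add h4; rewrite leq_mul2r; apply/orP; right.
by rewrite leq_mul // leq_mul // leq_mul.
Qed.

Theorem theorem1 (R : realType) :
  exists (C eps0 : R) (k : nat), 0 < C /\ 0 < eps0 /\
  forall (V : finType) (w : V -> R), (forall v, 0 < w v) ->
  forall eps : R, 0 < eps -> eps < eps0 ->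
  exists (St : Type) (s0 : St) (h : St -> update V -> Comp R V (St * {set V})),
  forall f : {set V} -> R,
    (forall A, 0 <= f A) -> monotone_setfun f -> submodular f ->
  forall us : seq (update V), (0 < size us)%N ->
    let X := present us in
    let c := run h s0 us set0 in
    (1 - C * eps) * f X <= Ex f c 0 (fun _ S => f S) /\
    AllLeaves f c (fun S => S \subset X /\ Cost w S <= C / eps * OPT f w X) /\
    Ex f c 0 (fun q _ => q%:R) <=
      (size us)%:R * (C * (1 + ln (#|V|%:R) + ln (rho w) + eps^-1) ^+ k).
Proof.
pose e : R := expR 1; have e_gt0 : 0 < e by apply: expR_gt0.
have [q0 [q0_gt0 q0_gt]] : exists q0 : nat, (0 < q0)%N /\ 2 * e < q0%:R.
  by exists (Num.truncn (2 * e)).+1; split=> //; apply: truncnS_gt.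
(* [e] serves the cost, 2 the value and the rest the queries; [128 = 2 ^ 7] comes from
   [N <= A + 1 <= 2 * A]. *)
exists (e + 2 + 292 * 128 * q0%:R), 1, 7%N.
have q00 : 0 <= q0%:R :> R by apply: ler0n.
split; first lra.
split=> // V w w_gt0 eps eps_gt0 eps_lt1.
pose A := 1 + ln (#|V|%:R) + ln (rho w) + eps^-1.
(* [N] is fixed before the updates, whereas [A] is shown nonnegative only once an update provides an
   element of [V]; hence the guard. *)
have [N [A_lt N_le]] : exists N : nat, A < N%:R /\ (0 <= A -> N%:R <= A + 1).
  exists (Num.truncn A).+1; split; first exact: truncnS_gt.
  by rewrite -truncn_le -addn1 natrD lerD2r.
exists _, None, (handle w eps N (q0 * N ^ 2)) => f f_ge0 fmono fsub us us_gt0.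
have v0 : V by case: us us_gt0 => // -[].
have n_gt0 : 1 <= #|V|%:R :> R.
  by rewrite ler1n -cardsT; apply/card_gt0P; exists v0; rewrite inE.
have rho1 := rho_ge1 w_gt0 v0.
have ln_n := ln_ge0 n_gt0; have ln_rho := ln_ge0 rho1.
have ie_gt0 : 0 < eps^-1 by rewrite invr_gt0.
have A_ge1 : 1 <= A by rewrite /A; lra.
have N_gt0 : (0 < N)%N by rewrite -(ltr_nat R) (le_lt_trans _ A_lt) // (le_trans ler01).
have ln_n_lt : ln (#|V|%:R : R) < N%:R by apply: (le_lt_trans _ A_lt); rewrite /A; lra.
have ie_le : eps^-1 <= A by rewrite /A; lra.
have ie_lt : eps^-1 < N%:R := le_lt_trans ie_le A_lt.
have expN : e ^+ N = expR N%:R by rewrite -expRM_natl mulr1.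
have [] := @handle_correct R V w eps N (q0 * N ^ 2) f f_ge0 fmono fsub w_gt0
  eps_gt0 eps_lt1 v0 N_gt0 _ _ _ us us_gt0.
(* [expR A] is the product of [e], [#|V|], [rho w] and [expR eps^-1], and the last factor is at
   least [eps^-1]. *)
- rewrite -/e expN; apply: (@le_trans _ _ (expR A)); last by rewrite ler_expR ltW.
  rewrite /A !expRD !lnK ?posrE ?(lt_le_trans ltr01) // -/e.
  rewrite (_ : _ * e = e * #|V|%:R * rho w * eps^-1); last by ring.
  have ie_expR : eps^-1 <= expR eps^-1 by apply: le_trans (expR_ge1Dx _); rewrite lerDr.
  have enr_ge0 : 0 <= e * #|V|%:R * rho w.
    exact: mulr_ge0 (mulr_ge0 (ltW e_gt0) (ler0n _ _)) (le_trans ler01 rho1).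
  exact: (ler_wpM2l enr_ge0 ie_expR).
- rewrite -(ltr_nat R) natrX.
  have -> : #|V|%:R = expR (ln #|V|%:R) :> R by rewrite lnK // posrE (lt_le_trans ltr01).
  apply: (@lt_le_trans _ _ (expR N%:R)).
    by rewrite ltr_expR.
  rewrite -expN exprM lerXn2r ?nnegrE // ?(ltW e_gt0) // expr2; first lra.
  by apply: le_trans (expR1_le4 R) _; lra.
- rewrite -/e.
  have -> : eps / (2 * N)%:R * (q0 * N ^ 2)%:R = eps * N%:R * (q0%:R / 2) :> R.
    by rewrite !natrM; field; rewrite gt_eqF // (lt_trans ie_gt0).
  have eN : 1 <= eps * N%:R by rewrite -ler_pdivrMl // mulr1 ltW.
  apply: (@le_trans _ _ (q0%:R / 2)); first lra.
  by rewrite ler_peMl //; lra.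
move=> value leaves queries; split; last split.
- apply: le_trans value; rewrite ler_wpM2r // lerB // ler_pM2r //; lra.
- apply: AllLeaves_imp leaves => S [SX h]; split=> //; apply: le_trans h _.
  have [O [_ _ ->]] := OPT_attained w_gt0 f (present us).
  rewrite ler_wpM2r ?Cost_ge0 // ler_pM2r // -/e; lra.
- apply: le_trans queries _; rewrite ler_wpM2l // -/A.
  apply: (@le_trans _ _ (292 * q0 * N ^ 7)%:R); first by rewrite ler_nat query_bound.
  rewrite natrM natrX natrM; apply: (@le_trans _ _ (292 * q0%:R * (2 * A) ^+ 7)).
    rewrite ler_wpM2l ?mulr_ge0 // lerXn2r ?nnegrE //; first lra.
    by apply: le_trans (N_le _) _; lra.
  have A7 : 0 <= A ^+ 7 by rewrite exprn_ge0 //; lra.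
  rewrite exprMn (_ : _ * (2 ^+ 7 * _) = 292 * 128 * q0%:R * A ^+ 7); last by ring.
  by rewrite ler_wpM2r //; lra.
Qed.
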